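(* Let $1<p<\infty$ and let $X$ be a Banach space with an unconditional basis. Then every $\ell_2$-strictly singular bounded linear operator $T:L_p\to X$ is narrow.
   Context: All spaces are real. $L_p$ denotes $L_p[0,1]$ with Lebesgue measure $\mu$. A bounded linear operator $T:L_p\to X$ is called narrow if for every $\varepsilon>0$ and every Lebesgue measurable set $A\subseteq[0,1]$ there exists $x\in L_p$ with $x^2=\mathbf 1_A$ (a.e.), $\int_{[0,1]}x\,d\mu=0$ and $\|Tx\|<\varepsilon$. For Banach spaces $Y,X,Z$, a bounded linear operator $T:Y\to X$ is called $Z$-strictly singular if for every closed subspace $H\subseteq Y$ isomorphic to $Z$ the restriction $T|_H$ is not an isomorphism onto its image. *)

(* Defs.v *)
From HB Require Import structures.
From mathcomp Require Import all_boot all_order all_algebra.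
From mathcomp Require Import all_classical all_reals all_analysis.
From mathcomp Require Import measurable_realfun hoelder ess_sup_inf.

Set Implicit Arguments.
Unset Strict Implicit.
Unset Printing Implicit Defensive.
Import Order.TTheory GRing.Theory Num.Theory.
Import numFieldNormedType.Exports.
Local Open Scope classical_set_scope.
Local Open Scope ring_scope.

(* The library's [LspaceType mu p1] is a bare type of classes of a.e. equal
   p-integrable functions; here it becomes a normed space, with operations
   computed on representatives and norm ['N[mu]_p]. *)
Section Lspace_normedModType.
Context d (T : measurableType d) (R : realType).
Variables (mu : {measure set T -> \bar R}) (p : \bar R) (p1 : (1 <= p)%E).

Lemma ae_eq_Lnorm (f g : {mfun T >-> R}) : f = g %[ae mu] ->
  'N[mu]_p[EFin \o f]%E = 'N[mu]_p[EFin \o g]%E.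
Proof.
move=> fg; rewrite unlock; case: p p1 => [r r1|_|//].
- have mpow (h : {mfun T >-> R}) : measurable_fun setT (fun x => `|h x| `^ r).
    apply: (measurableT_comp (measurable_powR _)) => //.
    exact: measurableT_comp.
  congr (_ `^ _)%E; apply: ae_eq_integral => //=.
  + exact/measurable_EFinP/mpow.
  + exact/measurable_EFinP/mpow.
  + by apply: filterS fg => x fgx xT; rewrite fgx.
- case: ifPn => // mu0; apply: eq_ess_sup.
  by apply: filterS fg => x /= ->.
Qed.

Local Notation L := (LspaceType mu p1).
Local Notation F := (LfunType mu p1).

Section Lrepr.
Variable f : L.
Let g : T -> R := f.

Let g_measurable : measurable_fun setT g.
Proof.
exact: (@measurable_funPT _ _ _ _ (repr (f : {mfun_ mu, T >-> measurableTypeR R}))).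
Qed.
#[local] HB.instance Definition _ := isMeasurableFun.Build d _ T R g g_measurable.

Let g_finite : finite_norm mu p g.
Proof. exact: Lebesgue_finite. Qed.
#[local] HB.instance Definition _ := isLfunction.Build d T R mu p p1 g g_finite.

Definition Lrepr : F := [the LfunType mu p1 of g].
End Lrepr.

Section Lpi.
Variable f : F.
Let g : T -> measurableTypeR R := f.

Let g_measurable : measurable_fun setT g.
Proof. exact: (@measurable_funPT _ _ _ _ f). Qed.
#[local] HB.instance Definition _ :=
  isMeasurableFun.Build d _ T (measurableTypeR R) g g_measurable.

Definition Lpi_class : {mfun_ mu, T >-> measurableTypeR R} :=
  \pi_({mfun_ mu, T >-> measurableTypeR R})%qT
    [the {mfun T >-> measurableTypeR R} of g].

Lemma Lpi_class_ae : (Lpi_class : T -> R) = f %[ae mu].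
Proof.
by have /eqmodP/asboolP := reprK Lpi_class.
Qed.


Let Lpi_class_finite : finite_norm mu p (Lpi_class : T -> R).
Proof.
rewrite /finite_norm.
have mh : measurable_fun setT (Lpi_class : T -> R).
  exact: (@measurable_funPT _ _ _ _ (repr Lpi_class)).
pose h := isMeasurableFun.Build d _ T R Lpi_class mh.
rewrite (@ae_eq_Lnorm (MeasurableFun.Pack (MeasurableFun.Class h)) f).
  exact: Lfunction_finite.
exact: Lpi_class_ae.
Qed.

Definition Lpi : L := LebesgueSpace.Pack
  (LebesgueSpace.Class
    (isFinLebesgue.Build d T R mu p p1 Lpi_class Lpi_class_finite)).

End Lpi.

Lemma LpiE (f : F) : (Lpi f : T -> R) = f %[ae mu].
Proof. exact: Lpi_class_ae. Qed.

Lemma Lspace_eqP (f g : L) : f = g <-> (f : T -> R) = g %[ae mu].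
Proof.
split=> [->|]; first exact: nearW.
case: f g => f [[cf]] [g [[cg]]] /= fg.
have {}fg : f = g.
  by rewrite -[f]reprK -[g]reprK; apply/eqmodP/asboolP.
by subst g; rewrite (Prop_irrelevance cf cg).
Qed.

Definition Lspace_zero : L := Lpi 0.
Definition Lspace_opp (f : L) : L := Lpi (- Lrepr f).
Definition Lspace_add (f g : L) : L := Lpi (Lrepr f + Lrepr g).
Definition Lspace_scale (a : R) (f : L) : L := Lpi (a *: Lrepr f).

HB.instance Definition _ := gen_eqMixin L.
HB.instance Definition _ := gen_choiceMixin L.

Lemma Lspace_addE (f g : L) :
  \forall x \ae mu, Lspace_add f g x = (f x : R) + (g x : R) :> R.
Proof. by have := LpiE (Lrepr f + Lrepr g); apply: filterS => x ->. Qed.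

Lemma Lspace_oppE (f : L) : \forall x \ae mu, Lspace_opp f x = - (f x : R) :> R.
Proof. by have := LpiE (- Lrepr f); apply: filterS => x ->. Qed.

Lemma Lspace_scaleE (a : R) (f : L) :
  \forall x \ae mu, Lspace_scale a f x = a * (f x : R) :> R.
Proof. by have := LpiE (a *: Lrepr f); apply: filterS => x ->. Qed.

Lemma Lspace_zeroE : \forall x \ae mu, Lspace_zero x = 0 :> R.
Proof. by have := LpiE 0; apply: filterS => x ->. Qed.

Let addA : associative Lspace_add.
Proof.
move=> f g h; apply/Lspace_eqP; near=> x.
rewrite (near (Lspace_addE f (Lspace_add g h)) x)//.
rewrite (near (Lspace_addE (Lspace_add f g) h) x)//.
rewrite (near (Lspace_addE g h) x)//.
by rewrite (near (Lspace_addE f g) x)// addrA.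
Unshelve. all: by end_near. Qed.

Let addC : commutative Lspace_add.
Proof.
move=> f g; apply/Lspace_eqP; near=> x.
rewrite (near (Lspace_addE f g) x)//.
by rewrite (near (Lspace_addE g f) x)// addrC.
Unshelve. all: by end_near. Qed.

Let add0 : left_id Lspace_zero Lspace_add.
Proof.
move=> f; apply/Lspace_eqP; near=> x.
rewrite (near (Lspace_addE Lspace_zero f) x)//.
by rewrite (near Lspace_zeroE x)// add0r.
Unshelve. all: by end_near. Qed.

Let addN : left_inverse Lspace_zero Lspace_opp Lspace_add.
Proof.
move=> f; apply/Lspace_eqP; near=> x.
rewrite (near (Lspace_addE (Lspace_opp f) f) x)//.
rewrite (near (Lspace_oppE f) x)//.
by rewrite (near Lspace_zeroE x)// addNr.
Unshelve. all: by end_near. Qed.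

HB.instance Definition _ := GRing.isZmodule.Build L addA addC add0 addN.

Let scaleA a b (f : L) :
  Lspace_scale a (Lspace_scale b f) = Lspace_scale (a * b) f.
Proof.
apply/Lspace_eqP; near=> x.
rewrite (near (Lspace_scaleE a (Lspace_scale b f)) x)//.
rewrite (near (Lspace_scaleE b f) x)//.
by rewrite (near (Lspace_scaleE (a * b) f) x)// mulrA.
Unshelve. all: by end_near. Qed.

Let scale1 : left_id 1 Lspace_scale.
Proof.
move=> f; apply/Lspace_eqP; near=> x.
by rewrite (near (Lspace_scaleE 1 f) x)// mul1r.
Unshelve. all: by end_near. Qed.

Let scaleDr : right_distributive Lspace_scale +%R.
Proof.
move=> a f g; apply/Lspace_eqP; near=> x.
rewrite (near (Lspace_scaleE a (f + g)) x)//.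
rewrite (near (Lspace_addE (Lspace_scale a f) (Lspace_scale a g)) x)//.
rewrite (near (Lspace_addE f g) x)//.
rewrite (near (Lspace_scaleE a f) x)//.
by rewrite (near (Lspace_scaleE a g) x)// mulrDr.
Unshelve. all: by end_near. Qed.

Let scaleDl (f : L) : {morph Lspace_scale^~ f : a b / a + b}.
Proof.
move=> a b; apply/Lspace_eqP; near=> x.
rewrite (near (Lspace_scaleE (a + b) f) x)//.
rewrite (near (Lspace_addE (Lspace_scale a f) (Lspace_scale b f)) x)//.
rewrite (near (Lspace_scaleE a f) x)//.
by rewrite (near (Lspace_scaleE b f) x)// mulrDl.
Unshelve. all: by end_near. Qed.

HB.instance Definition _ :=
  GRing.Zmodule_isLmodule.Build R L scaleA scale1 scaleDr scaleDl.

Definition Lspace_norm (f : L) : R := fine ('N[mu]_p[EFin \o (f : T -> R)])%E.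

Let norm_Lpi (f : F) : Lspace_norm (Lpi f) = fine ('N[mu]_p[EFin \o f])%E.
Proof. by congr fine; apply: (@ae_eq_Lnorm (Lrepr (Lpi f)) f); exact: LpiE. Qed.

Let normD (f g : L) : Lspace_norm (f + g) <= Lspace_norm f + Lspace_norm g.
Proof. by rewrite norm_Lpi; exact: (ler_LnormD (Lrepr f) (Lrepr g)). Qed.

Let normZ a (f : L) : Lspace_norm (a *: f) = `|a| * Lspace_norm f.
Proof.
rewrite norm_Lpi; apply: EFin_inj; rewrite EFinM.
rewrite (finite_norm_fine (a *: Lrepr f)) (finite_norm_fine (Lrepr f)).
exact: LnormZ.
Qed.

Let norm0_eq0 (f : L) : Lspace_norm f = 0 -> f = 0.
Proof.
move=> /(@fine_Lnormr_eq0 _ _ _ _ _ _ (Lrepr f)) f0.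
apply/Lspace_eqP; near=> x.
rewrite (near Lspace_zeroE x)//.
rewrite -[LHS]/(Lrepr f x).
by rewrite (near f0 x).
Unshelve. all: by end_near. Qed.

HB.instance Definition _ :=
  @Lmodule_isNormed.Build R L Lspace_norm normD normZ norm0_eq0.

End Lspace_normedModType.

Section normed_spaces.
Context (R : realType).

Definition linear_on (U V : normedModType R) (H : set U) (f : U -> V) :=
  forall a : R, {in H &, forall u v, f (a *: u + v) = a *: f u + f v}.

Definition bounded_on (U V : normedModType R) (H : set U) (f : U -> V) :=
  exists C : R, {in H, forall u, `|f u| <= C * `|u|}.

(* Maps between subspaces are total functions whose values outside [H] (or
   [K]) are irrelevant; [g] is automatically linear on [K]. *)
Definition isomorphism_onto (U V : normedModType R)
    (H : set U) (K : set V) (f : U -> V) :=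
  [/\ linear_on H f, bounded_on H f &
    exists g : V -> U,
      [/\ bounded_on K g,
          {homo f : u / H u >-> K u}, {homo g : v / K v >-> H v},
          {in H, cancel f g} & {in K, cancel g f}]].

Definition isomorphic (U V : normedModType R) (H : set U) (K : set V) :=
  exists f : U -> V, isomorphism_onto H K f.

Definition strictly_singular (Z Y X : normedModType R) (T : Y -> X) :=
  forall H : set Y, submod_closed (mem H) -> closed H ->
    isomorphic H [set: Z] -> ~ isomorphism_onto H (T @` H) T.

(* Indexing by [nat] together with uniqueness of the expansion makes a space
   with a basis infinite-dimensional. *)
Definition schauder_basis (X : normedModType R) (e : nat -> X) :=
  forall x : X,
    exists! a : nat -> R, series (fun n => a n *: e n) @ \oo --> x.

Definition unconditionally_cvgn (X : normedModType R) (u : nat -> X) :=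
  forall s : nat -> nat, bijective s -> cvgn (series (u \o s)).

Definition unconditional_basis (X : normedModType R) (e : nat -> X) :=
  schauder_basis e /\
  forall a : nat -> R, cvgn (series (fun n => a n *: e n)) ->
    unconditionally_cvgn (fun n => a n *: e n).

End normed_spaces.

Section Lp_unit_interval.
Context (R : realType).

Definition lebesgue01 : {measure set (measurableTypeR R) -> \bar R} :=
  mrestr lebesgue_measure (measurable_itv `[0%R, 1%R]).

(* The functions are defined on the whole line but, [lebesgue01] being carried
   by [0, 1], they are identified as soon as they agree almost everywhere
   there. *)
Definition Lp01 (p : R) (p_gt1 : 1 < p) :=
  LspaceType lebesgue01 (ltW p_gt1 : (1 <= p%:E)%E).

HB.instance Definition _ (p : R) (p_gt1 : 1 < p) :=
  NormedModule.on (Lp01 p_gt1).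

Definition ell2 := LspaceType2 (counting : {measure set nat -> \bar R}).

HB.instance Definition _ := NormedModule.on ell2.

(* The library's [measurable] sets of reals are the Borel sets; the Lebesgue
   sets are those satisfying the Caratheodory criterion for the outer
   measure. *)
Definition lebesgue_measurable (A : set R) :=
  ((@wlength R idfun)^*)%mu.-cara.-measurable A.

Definition narrow (p : R) (p_gt1 : 1 < p) (X : normedModType R)
    (T : Lp01 p_gt1 -> X) :=
  forall (eps : R) (A : set R), 0 < eps ->
    lebesgue_measurable A -> A `<=` `[0, 1] ->
    exists x : Lp01 p_gt1,
      [/\ \forall t \ae lebesgue01, (x t : R) ^+ 2 = \1_A t,
          (\int[lebesgue01]_t (x t)%:E = 0)%E & `|T x| < eps].

End Lp_unit_interval.

(* Main.v *)
Require Import Defs.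
From HB Require Import structures.
From mathcomp Require Import all_boot all_order all_algebra.
From mathcomp Require Import all_classical all_reals all_analysis.
From mathcomp Require Import measurable_realfun.
From mathcomp Require Import ring lra.

Set Implicit Arguments.
Unset Strict Implicit.
Unset Printing Implicit Defensive.
Import Order.TTheory GRing.Theory Num.Theory.
Import numFieldNormedType.Exports.
Local Open Scope classical_set_scope.
Local Open Scope ring_scope.

(** Suppose that [T] is not narrow: some set [A] of the unit interval carries
    only mean zero signs [x] (that is, [x ^+ 2 = \1_A]) with [`|T x|] at least
    a fixed [delta > 0]. The proof finds in [L_p] a sequence of Rademacher
    functions whose closed span is isomorphic to [ell2] and on which [T] is an
    isomorphism.

    Haar functions with block images. An operator of finite rank is small on
    some mean zero sign of any given set, since Rademacher functions are weakly
    null ([good_half]). Composing [T] with the projections onto the first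
    coordinates of the basis and halving [A] again and again along such signs
    yields a dyadic tree of sets whose Haar functions have images close to
    consecutive blocks of the basis ([adaptive_tree]). As the basis is
    unconditional, deleting terms from a linear combination of these images
    multiplies its norm by at most a constant [K], up to a small error
    ([unconditional_constant], [block_projection]).

    Upper estimate. The sums [rad n] of the Haar functions of a level are
    independent signs, so by Khintchine's inequality ([khintchine_rad]) the norm
    of [\sum_n a n *: rad n] is at most a constant times the [ell2] norm of [a].

    Lower estimate ([rad_lower]). Let [\sum_n a n ^+ 2 = s] with [s] large. If
    some [`|a n|] is not small, delete all levels but [n]; there remains the
    image of [a n *: rad n], and [rad n] is a mean zero sign. If all [`|a n|]
    are small, stop the random walk [\sum_n a n *: rad n] when it leaves the
    interval ]-1, 1[. The stopped walk arises by deleting Haar functions from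
    the sum ([stopped_haar]), so its image is controlled by that of the sum. On
    the other hand it is close in [L_p] to a mean zero sign: it overshoots
    1 or -1 only slightly, it is symmetric, and as its second moment is bounded
    it fails to exit with probability at most [4 / s]. So its image has norm at
    least [delta / 2]. By homogeneity, [T] is bounded below on the span of the
    [rad n] by a constant times the [ell2] norm of the coefficients.

    Since [L_p] and [ell2] are complete ([Lspace_complete]), the two estimates
    give a closed copy of [ell2] on which [T] is an isomorphism
    ([not_strictly_singular_of_ell2]). *)

(** * Unconditional bases and coordinate projections *)

Lemma cauchy_tail_cvgn (R : realType) (V : completeNormedModType R)
    (u : nat -> V) :
  (forall eps : R, 0 < eps -> exists N, forall i, `|u (N + i)%N - u N| < eps) ->
  cvgn u.
Proof.
move=> hu; apply: cauchy_cvg; apply: cauchy_exP => eps e0.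
have [N hN] := hu eps e0; exists (u N); exists N => // n /= Nn.
by rewrite -ball_normE /ball_ /= distrC -(subnKC Nn); exact: hN.
Qed.

Lemma cvg_norm_le (R : realType) (V : normedModType R) (u : nat -> V) l c :
  u @ \oo --> l -> (forall i, `|u i| <= c) -> `|l| <= c.
Proof.
move=> ul uc; apply/ler_addgt0Pr => eps e0.
have /cvgrPdist_lt/(_ _ e0)[N _ /(_ N (leqnn N)) /ltW hN] := ul.
by rewrite -[l](subrK (u N)) addrC (le_trans (ler_normD _ _))// lerD.
Qed.

Section unconditional_rearrangement.
Context (R : realType) (X : completeNormedModType R) (u : nat -> X).

(** Otherwise there are, arbitrarily far out, finite sets of indices whose sums
    have norm at least [eps]. The rearrangement which, inside consecutive
    intervals, lists such a set first has partial sums that are not Cauchy. *)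
Lemma unconditional_tail_small (eps : R) : unconditionally_cvgn u -> 0 < eps ->
  exists N, forall (P : pred nat) M, `|\sum_(N <= k < M | P k) u k| < eps.
Proof.
move=> uu e0; apply: contrapT => /forallNP H.
have {}H N : exists PM : pred nat * nat,
    eps <= `|\sum_(N <= k < PM.2 | PM.1 k) u k|.
  apply: contrapT => /forallNP H'; apply: (H N) => P M.
  by rewrite ltNge; apply/negP => h; apply: (H' (P, M)).
case/choice: H => PM hPM.
pose P N := (PM N).1; pose M N := (PM N).2.
have NM N : (N < M N)%N.
  rewrite ltnNge; apply/negP => MN; have := hPM N.
  by rewrite -/(M N) big_geq// normr0 leNgt e0.
pose fix N k := if k is k'.+1 then M (N k') else 0%N.
pose F k := [seq i <- index_iota (N k) (N k.+1) | P (N k) i].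
pose G k := [seq i <- index_iota (N k) (N k.+1) | ~~ P (N k) i].
pose fix L k := if k is k'.+1 then L k' ++ (F k' ++ G k') else [::].
(* The lists [L k] enumerate [[0, N k)] and each is a prefix of the next, so
   that they define a permutation [s] of [nat], with inverse [t]. *)
have permL k : perm_eq (L k) (index_iota 0 (N k)).
  elim: k => [|k IH]; first by rewrite /= /index_iota.
  have -> : index_iota 0 (N k.+1) = index_iota 0 (N k) ++
    index_iota (N k) (N k.+1).
    by rewrite /index_iota !subn0 -{2}(add0n (N k)) -iotaD
      subnKC// ltnW//; exact: NM.
  by apply: perm_cat => //; apply/permPl; apply: perm_filterC.
have sizeL k : size (L k) = N k.
  by rewrite (perm_size (permL k)) size_iota subn0.
have memL k n : (n \in L k) = (n < N k)%N.
  by rewrite (perm_mem (permL k)) mem_index_iota.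
have uniqL k : uniq (L k) by rewrite (perm_uniq (permL k)) iota_uniq.
have kN k : (k <= N k)%N.
  by elim: k => // k IH; apply: (leq_ltn_trans IH); exact: NM.
have prefL j k : (j <= k)%N -> exists l, L k = L j ++ l.
  move=> /subnKC <-; elim: (k - j)%N => [|i [l IH]].
    by exists [::]; rewrite addn0 cats0.
  by rewrite addnS /= IH -catA; eexists.
pose s n := nth 0%N (L n.+1) n.
have sE k n : (n < N k)%N -> s n = nth 0%N (L k) n.
  move=> nk; rewrite /s; have [/prefL[l ->]|/ltnW/prefL[l ->]] := leqP k n.+1.
    by rewrite nth_cat sizeL nk.
  by rewrite nth_cat sizeL (leq_trans _ (kN _)).
pose t m := index m (L m.+1).
have tE k m : (m < N k)%N -> t m = index m (L k).
  move=> nk; rewrite /t; have [/prefL[l ->]|/ltnW/prefL[l ->]] := leqP k m.+1.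
    by rewrite index_cat memL nk.
  have mL : m \in L m.+1 by rewrite memL; exact: kN.
  by rewrite [RHS]index_cat mL.
have bij_s : bijective s.
  exists t => n.
    have nN : (n < N n.+1)%N by exact: (leq_trans _ (kN _)).
    have snN : (s n < N n.+1)%N by rewrite -memL mem_nth ?sizeL.
    by rewrite (tE n.+1)// (sE n.+1)// index_uniq ?sizeL.
  have nN : (n < N n.+1)%N by exact: (leq_trans _ (kN _)).
  have tnN : (t n < N n.+1)%N by rewrite -sizeL index_mem memL.
  by rewrite (sE n.+1)// (tE n.+1)// nth_index// memL.
have [n0 hn0] : exists n0, forall n m, (n0 <= n)%N -> (n0 <= m)%N ->
    `|\sum_(n <= k < m) u (s k)| < eps.
  have /cvg_cauchy/cauchy_seriesP/(_ _ e0) := uu s bij_s.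
  case=> -[A B] /= [[a _ Aa] [b _ Bb]] AB; exists (maxn a b) => n m.
  rewrite !geq_max => /andP[an _] /andP[_ bm].
  by apply: (AB (n, m)); split; [exact: Aa|exact: Bb].
have /prefL := leqnSn n0 => -[l Ll].
have {}Ll : L n0.+1 = (L n0 ++ F n0) ++ G n0 by rewrite /= catA.
have := hn0 (N n0) (N n0 + size (F n0))%N (kN _)
  (leq_trans (kN _) (leq_addr _ _)).
rewrite ltNge => /negP; apply; apply: le_trans (hPM (N n0)) _.
have -> : \sum_(N n0 <= k < N n0 + size (F n0)) u (s k) =
    \sum_(0 <= k < size (F n0)) u (s (k + N n0)%N).
  by rewrite -{1}(add0n (N n0)) big_addn addKn.
rewrite -big_filter -/(P _) -/(M _) -/(N n0.+1) -/(F n0) (big_nth 0%N).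
rewrite le_eqVlt; apply/orP; left; apply/eqP; congr `|_|.
apply: eq_big_nat => i /= iF; congr u.
have Fle : (N n0 + size (F n0) <= N n0.+1)%N.
  by rewrite -(sizeL n0.+1) -sizeL Ll -size_cat [leqRHS]size_cat leq_addr.
rewrite (sE n0.+1); last first.
  by rewrite (leq_trans _ Fle)// addnC ltn_add2l.
rewrite Ll -catA nth_cat sizeL ltnNge leq_addl /= addnK nth_cat.
by rewrite iF.
Qed.

Lemma unconditional_subsums_bounded : unconditionally_cvgn u ->
  exists C, forall (P : pred nat) M, `|\sum_(0 <= k < M | P k) u k| <= C.
Proof.
move=> /unconditional_tail_small/(_ ltr01)[N hN].
exists (\sum_(0 <= k < N) `|u k| + 1) => P M.
have small P' M' : (M' <= N)%N ->
    `|\sum_(0 <= k < M' | P' k) u k| <= \sum_(0 <= k < N) `|u k|.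
  move=> MN; apply: le_trans (ler_norm_sum _ _ _) _.
  rewrite (big_cat_nat (leq0n _) MN)//= big_mkcond/= -[leLHS]addr0.
  apply: lerD; last exact: sumr_ge0.
  by apply: ler_sum => i _; case: ifP.
have [MN|/ltnW NM] := leqP M N.
  by rewrite (le_trans (small P M MN))// lerDl.
rewrite (big_cat_nat (leq0n _) NM)//=; apply: le_trans (ler_normD _ _) _.
by apply: lerD; [exact: small|exact/ltW/hN].
Qed.

End unconditional_rearrangement.

Section basis_constant.
Context (R : realType) (X : completeNormedModType R) (e : nat -> X).

Definition basis_coef (be : schauder_basis e) (x : X) : nat -> R :=
  projT1 (cid (be x)).

Lemma basis_coef_cvg be x :
  series (fun n => basis_coef be x n *: e n) @ \oo --> x.
Proof. by rewrite /basis_coef; case: cid => a []. Qed.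

Lemma basis_coef_unique be x b :
  series (fun n => b n *: e n) @ \oo --> x -> basis_coef be x = b.
Proof. by rewrite /basis_coef; case: cid => a [_ h] /=; exact: h. Qed.

Lemma basis_coef_linear be a x y n :
  basis_coef be (a *: x + y) n = a * basis_coef be x n + basis_coef be y n.
Proof.
rewrite (@basis_coef_unique be _
  (fun n => a * basis_coef be x n + basis_coef be y n))//.
rewrite (_ : series _ = (fun M => a *:
  series (fun n => basis_coef be x n *: e n) M
    + series (fun n => basis_coef be y n *: e n) M)).
  apply: cvgD; last exact: basis_coef_cvg.
  by apply: cvgZr; exact: basis_coef_cvg.
apply/funext => M; rewrite /series /= scaler_sumr -big_split /=.
by apply: eq_bigr => k _; rewrite scalerDl scalerA.
Qed.

Definition basis_proj be (P : pred nat) M (x : X) : X :=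
  \sum_(0 <= k < M | P k) basis_coef be x k *: e k.

Lemma basis_proj_linear be P M a x y :
  basis_proj be P M (a *: x + y) = a *:
    basis_proj be P M x + basis_proj be P M y.
Proof.
rewrite /basis_proj scaler_sumr -big_split /=.
by apply: eq_bigr => k _; rewrite basis_coef_linear scalerDl scalerA.
Qed.

HB.instance Definition _ be P M := GRing.isLinear.Build R X X _
  (basis_proj be P M) (basis_proj_linear be P M).

Lemma basis_coef_finite be (b : nat -> R) (Q : pred nat) N M n :
  basis_coef be (\sum_(N <= k < M | Q k) b k *: e k) n =
  if (N <= n < M)%N && Q n then b n else 0.
Proof.
rewrite (@basis_coef_unique be _
  (fun n => if (N <= n < M)%N && Q n then b n else 0))//.
apply: (@cvg_near_cst _ _ _ _ _ _).
near=> m.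
rewrite /series /=.
have Mm : (M <= m)%N by near: m; exact: nbhs_infty_ge.
rewrite (big_cat_nat (leq0n _) Mm)//= [X in _ + X]big_nat
  [X in _ + X]big1 ?addr0; last first.
  by move=> i /andP[Mi _]; rewrite (ltnNge i) Mi /= andbF scale0r.
have [NM|/ltnW MN] := leqP N M; last first.
  rewrite [RHS]big_geq// [LHS]big_nat [LHS]big1// => i /andP[_ iM].
  by rewrite leqNgt (leq_trans iM MN) scale0r.
rewrite (big_cat_nat (leq0n _) NM)//= [X in X + _]big_nat
  [X in X + _]big1 ?add0r; last first.
  by move=> i /andP[_ iN]; rewrite leqNgt iN scale0r.
rewrite [LHS]big_nat [RHS]big_mkcond [RHS]big_nat.
by apply: eq_bigr => i -> /=; case: ifP => // _; rewrite scale0r.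
Unshelve. all: by end_near. Qed.

Lemma basis_proj_finite be (P Q : pred nat) (b : nat -> R) N M' M :
  (M' <= M)%N ->
  basis_proj be P M (\sum_(N <= k < M' | Q k) b k *: e k) =
  \sum_(N <= k < M' | P k && Q k) b k *: e k.
Proof.
move=> M'M.
rewrite /basis_proj (big_cat_nat (leq0n _) M'M)//= [X in _ + X]big_nat_cond
  [X in _ + X]big1 ?addr0.
  have [NM|/ltnW MN] := leqP N M'; last first.
    rewrite [RHS]big_geq// [LHS]big_nat_cond [LHS]big1// =>
      i /andP[/andP[_ iM] _].
    by rewrite basis_coef_finite leqNgt (leq_trans iM MN) scale0r.
  rewrite (big_cat_nat (leq0n _) NM)//= [X in X + _]big_nat_cond
    [X in X + _]big1 ?add0r.
    rewrite [LHS]big_nat_cond [RHS]big_nat_cond big_mkcond [RHS]big_mkcond.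
    apply: eq_bigr => i _; rewrite basis_coef_finite.
    by case: (N <= i < M')%N; case: (P i) => //=; case: (Q i); rewrite ?scale0r.
  by move=> i /andP[/andP[_ iN] _]; rewrite basis_coef_finite leqNgt iN scale0r.
move=> i /andP[/andP[Mi _] _].
by rewrite basis_coef_finite (ltnNge i) Mi andbF scale0r.
Qed.

Lemma basis_vec_neq0 (be : schauder_basis e) n : e n != 0.
Proof.
apply/eqP => en0.
have h1 : basis_coef be 0 = (fun=> 0).
  apply: basis_coef_unique;
    rewrite (_ : series _ = cst 0); first exact: cvg_cst.
  by apply/funext => M; rewrite /series /= big1// => i _; rewrite scale0r.
have h2 : basis_coef be 0 = (fun k => (k == n)%:R).
  apply: basis_coef_unique;
    rewrite (_ : series _ = cst 0); first exact: cvg_cst.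
  apply/funext => M; rewrite /series /= big1// => i _.
  by case: eqP => [->|_]; rewrite ?en0 ?scaler0 ?scale0r.
have /eqP : (0 : R) = 1.
  by move: h1; rewrite h2 => /(congr1 (fun f => f n)); rewrite eqxx.
by rewrite eq_sym oner_eq0.
Qed.

Lemma basis_proj1 be n x :
  basis_proj be (pred1 n) n.+1 x = basis_coef be x n *: e n.
Proof.
by rewrite /basis_proj big_mkord (big_pred1 ord_max).
Qed.

Lemma basis_proj_cvg be x : basis_proj be xpredT n x @[n --> \oo] --> x.
Proof.
rewrite (_ : (fun n => _) = series (fun k => basis_coef be x k *: e k)).
  exact: basis_coef_cvg.
by apply/funext.
Qed.

Let proj_le be x c := forall P M, `|basis_proj be P M x| <= c.

(** By Baire's theorem the vectors all of whose partial projections have norm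
    at most some [m] are dense in a ball. Differences of two such vectors are
    dense in a ball around 0, and homogeneity does the rest. *)
Let baire_dense be : (forall x, exists c, proj_le be x c) ->
  exists2 C, 0 < C & forall (y : X) eps, 0 < eps ->
    exists2 b, `|y - b| < eps & proj_le be b (C * `|y|).
Proof.
move=> bnd.
pose F (m : nat) : set X := ~` closure [set x | proj_le be x m%:R].
have [m [D [x0 Dx0] [openD DF]]] : exists m, exists2 D : set X, D !=set0 &
    open D /\ forall x, D x -> ~ F m x.
  apply: contrapT => H.
  have dF i : open (F i) /\ dense (F i).
    split; first by rewrite openC; exact: closed_closure.
    move=> D D0 oD; apply: contrapT => DF; apply: H; exists i, D => //.
    by split=> // x Dx Fx; apply: DF; exists x.
  have /(_ setT) [] := Baire dF; [by exists 0|exact: openT|].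
  move=> x [_ Fx]; have [c xc] := bnd x.
  apply: (Fx (Num.truncn c).+1 I); apply: subset_closure => P M.
  by rewrite (le_trans (xc P M))// ltW// truncnS_gt.
have {}DF x : D x -> closure [set x | proj_le be x m%:R] x.
  by move=> /DF /contrapT.
have [r r0 rD] : exists2 r, 0 < r & forall y, `|y| < r -> D (x0 + y).
  have /nbhs_ballP[r /= r0 rD] : nbhs x0 D by exact: open_nbhs_nbhs.
  exists r => // y yr; apply: rD; rewrite -ball_normE /ball_ /=.
  by rewrite opprD addrA subrr sub0r normrN.
have approx z eps : D z -> 0 < eps ->
    exists2 b, `|z - b| < eps & proj_le be b m%:R.
  move=> /DF zc e0; have := zc (ball z eps) (nbhsx_ballx _ _ e0).
  by case=> b [] /= hb; rewrite -ball_normE => zb; exists b.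
have small y eps : `|y| < r -> 0 < eps ->
    exists2 b, `|y - b| < eps & proj_le be b (m%:R + m%:R).
  move=> yr e0; have e2 : 0 < eps / 2 by rewrite divr_gt0.
  have [b1 yb1 hb1] := approx _ _ (rD _ yr) e2.
  have D0 : D x0 by rewrite -[x0]addr0; apply: rD; rewrite normr0.
  have [b2 yb2 hb2] := approx _ _ D0 e2.
  exists (b1 - b2).
    have -> : y - (b1 - b2) = (x0 + y - b1) - (x0 - b2).
      rewrite (addrC x0) -!addrA; congr (_ + _); rewrite !opprB.
      by rewrite [- b1 + _]addrA [x0 + _]addrC subrK addrC.
    rewrite (le_lt_trans (ler_normB _ _))//.
    by rewrite (splitr eps) ltrD.
  move=> P M; rewrite linearB.
  by apply: (le_trans (ler_normB _ _)); apply: lerD; [exact: hb1|exact: hb2].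
exists ((m%:R + m%:R + 1) * 2 / r) => [|y eps e0].
  by rewrite divr_gt0// mulr_gt0// ltr_wpDl// addr_ge0.
have [->|y0] := eqVneq y 0.
  by exists 0 => [|P M]; rewrite ?subr0 ?linear0 normr0 ?mulr0.
pose k := 2 * `|y| / r.
have k0 : 0 < k by rewrite divr_gt0// mulr_gt0// normr_gt0.
have [||b yb hb] := small (k^-1 *: y) (k^-1 * eps).
- rewrite normrZ gtr0_norm ?invr_gt0//.
  have -> : k^-1 * `|y| = r / 2 by rewrite /k; field;
    rewrite normr_eq0 y0 gt_eqF.
  by rewrite ltr_pdivrMr// ltr_pMr// ltr1n.
- by rewrite mulr_gt0// invr_gt0.
exists (k *: b).
  have -> : y - k *: b = k *: (k^-1 *: y - b).
    by rewrite scalerBr scalerA divff ?gt_eqF// scale1r.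
  by rewrite normrZ gtr0_norm// mulrC -ltr_pdivlMr// mulrC.
move=> P M; rewrite linearZ normrZ (gtr0_norm k0).
apply: (@le_trans _ _ (k * (m%:R + m%:R + 1))).
  by rewrite ler_pM2l//; apply: le_trans (hb P M) _; rewrite lerDl.
by rewrite /k; rewrite le_eqVlt; apply/orP; left; apply/eqP; ring.
Qed.

Lemma basis_projD_le be x y c d : proj_le be x c -> proj_le be y d ->
  proj_le be (x + y) (c + d).
Proof.
move=> xc yd P M; rewrite linearD.
by apply: (le_trans (ler_normD _ _)); apply: lerD; [exact: xc|exact: yd].
Qed.

(** Successive approximation, as for the open mapping theorem, with no
    continuity of the coefficients to start from: [x] is the limit of partial
    sums [Y J] whose increments have geometrically small projections. Hence the
    coefficients of [Y J] converge, and their limits are the coefficients of an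
    expansion of [x], thus those of [x] by uniqueness. *)
Lemma unconditional_basis_bound be : (forall x, exists c, proj_le be x c) ->
  exists2 K, 0 < K & forall P M x, `|basis_proj be P M x| <= K * `|x|.
Proof.
move=> bnd; have [C C0 HC] := baire_dense bnd.
exists (C * 2) => [|P M x]; first by rewrite mulr_gt0.
have [->|x0] := eqVneq x 0; first by rewrite linear0 !normr0 mulr0.
have nx : 0 < `|x| by rewrite normr_gt0.
have step j (y : X) : exists b, `|y - b| < `|x| * 2^-1 ^+ j.+1 /\
    proj_le be b (C * `|y|).
  have [|b yb hb] := HC y (`|x| * 2^-1 ^+ j.+1); last by exists b.
  by rewrite mulr_gt0// exprn_gt0// invr_gt0.
pose b j y := projT1 (cid (step j y)).
pose fix r j := if j is i.+1 then r i - b i (r i) else x.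
have rle j : `|r j| <= `|x| * 2^-1 ^+ j.
  case: j => [|j] /=; first by rewrite expr0 mulr1.
  by rewrite /b; case: cid => z [] /= /ltW.
have ble j : proj_le be (b j (r j)) (C * `|x| * 2^-1 ^+ j).
  move=> Q N; rewrite /b; case: cid => z [_] /= hz.
  by apply: le_trans (hz Q N) _; rewrite -mulrA ler_pM2l.
pose Y j := x - r j.
have YS j : Y j.+1 = Y j + b j (r j).
  by rewrite /Y /= opprB addrA addrAC.
have Ydiff J i : proj_le be (Y (J + i)%N - Y J)
    (C * `|x| * 2 * (2^-1 ^+ J - 2^-1 ^+ (J + i))).
  elim: i => [|i IH]; first by rewrite addn0 !subrr => Q N;
    rewrite linear0 normr0 mulr0.
  rewrite addnS YS addrAC.
  have -> : C * `|x| * 2 * (2^-1 ^+ J - 2^-1 ^+ (J + i).+1) =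
    C * `|x| * 2 * (2^-1 ^+ J - 2^-1 ^+ (J + i)) + C * `|x| * 2^-1 ^+ (J + i).
    by rewrite exprS; field.
  by apply: basis_projD_le.
have {}Ydiff J i : proj_le be (Y (J + i)%N - Y J) (C * `|x| * 2 * 2^-1 ^+ J).
  move=> Q N; apply: le_trans (Ydiff J i Q N) _.
  by rewrite ler_pM2l ?mulr_gt0// lerBlDr lerDl exprn_ge0// invr_ge0.
have geo0 c : c * 2^-1 ^+ j @[j --> \oo] --> (0 : R).
  rewrite -[X in _ --> X](mulr0 c); apply: cvgMr.
  by apply: cvg_expr; rewrite gtr0_norm ?invr_gt0// invf_lt1// ltr1n.
have geo_lt (c eps : R) : 0 < eps -> exists J, c * 2^-1 ^+ J < eps.
  move=> e0; have /cvgrPdist_lt/(_ _ e0)[J _ hJ] := geo0 c.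
  exists J; have := hJ J (leqnn J); rewrite sub0r normrN.
  by apply: le_lt_trans; exact: ler_norm.
have coefY n : cvgn (fun J => basis_coef be (Y J) n).
  apply: cauchy_tail_cvgn => eps e0.
  have en : 0 < `|e n| by rewrite normr_gt0; exact: basis_vec_neq0 be n.
  have [J hJ] := geo_lt (C * `|x| * 2) _ (mulr_gt0 e0 en).
  exists J => i; have := Ydiff J i (pred1 n) n.+1.
  rewrite basis_proj1 normrZ => /le_lt_trans/(_ hJ); rewrite ltr_pM2r//.
  have -> : Y (J + i)%N - Y J = (-1) *: Y J + Y (J + i)%N.
    by rewrite scaleN1r addrC.
  by rewrite basis_coef_linear mulN1r addrC.
pose c n := limn (fun J => basis_coef be (Y J) n).
have cY J Q N : `|\sum_(0 <= k < N | Q k) c k *: e k - basis_proj be Q N (Y J)|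
    <= C * `|x| * 2 * 2^-1 ^+ J.
  have lim1 : basis_proj be Q N (Y (J + i)%N - Y J) @[i --> \oo] -->
      \sum_(0 <= k < N | Q k) c k *: e k - basis_proj be Q N (Y J).
    under eq_fun do rewrite linearB /=.
    apply: cvgB; last exact: cvg_cst.
    apply: cvg_big => [|k _]; [exact: add_continuous|apply: cvgZl].
    under eq_fun do rewrite addnC.
    have := coefY k.
    by rewrite -/(c k) -(cvg_shiftn J (fun i => basis_coef be (Y i) k)).
  by apply: cvg_norm_le lim1 _ => i; exact: Ydiff.
have cx : basis_coef be x = c.
  apply: basis_coef_unique; apply/cvgrPdist_lt => eps e0.
  have [J hJ] := geo_lt (C * `|x| * 2 + `|x|) _ (divr_gt0 e0 (ltr0n _ 2)).
  have /cvgrPdist_lt/(_ _ (divr_gt0 e0 (ltr0n _ 2))) :=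
    @basis_proj_cvg be (Y J).
  apply: filterS => N hN; rewrite distrC.
  rewrite (_ : _ - x = (series (fun k => c k *: e k) N -
    basis_proj be xpredT N (Y J))
      + ((basis_proj be xpredT N (Y J) - Y J) - r J)); last first.
    by rewrite {2}/Y opprB (addrC (r J))
      (addrA (basis_proj _ _ _ _)) addrK addrA subrK.
  apply: le_lt_trans (ler_normD _ _) _.
  have h2 := ler_normB (basis_proj be xpredT N (Y J) - Y J) (r J).
  have h3 := cY J xpredT N; have h4 := rle J.
  rewrite distrC in hN; move: h3 hN h2;
    rewrite -/(series (fun k => c k *: e k) N).
  set A := `|_ - basis_proj _ _ _ _|; set B := `|_ - r J|; set D := `|_ - Y J|.
  by move: hJ; rewrite mulrDl => *; lra.
have := cY 0%N P M; rewrite /Y /= subrr linear0 subr0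
  expr0 mulr1 /basis_proj cx.
by rewrite mulrAC.
Qed.

End basis_constant.

Theorem unconditional_constant (R : realType) (X : completeNormedModType R)
    (e : nat -> X) (be : schauder_basis e) : unconditional_basis e ->
  exists2 K, 0 < K & forall P M x, `|basis_proj be P M x| <= K * `|x|.
Proof.
move=> [_ ue]; apply: unconditional_basis_bound => x.
have [|C hC] := @unconditional_subsums_bounded _ _
  (fun n => basis_coef be x n *: e n).
  by apply: ue; apply/cvg_ex; exists x; exact: basis_coef_cvg.
by exists C => P M; exact: hC.
Qed.

(** * Completeness of Lebesgue spaces *)

Lemma cvg_abs_powR (R : realType) (p : R) (u : nat -> R) l : 1 <= p ->
  u @ \oo --> l -> `|u n| `^ p @[n --> \oo] --> `|l| `^ p.
Proof.
move=> p1 ul; have ul' : `|u n| @[n --> \oo] --> `|l| by exact: cvg_norm.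
have p0 : 0 < p by exact: lt_le_trans p1.
have [l0|l0] := eqVneq l 0; last first.
  apply: (@cvg_comp _ _ _ (fun n => `|u n|) (fun a => a `^ p) _ _ _ ul').
  suff : {for `|l|, continuous (fun a : R => a `^ p)} by [].
  apply: differentiable_continuous; apply/derivable1_diffP.
  by apply: derivable_powR; rewrite in_itv /= normr_gt0 l0.
rewrite l0 normr0 powR0 ?gt_eqF//.
apply: (@squeeze_cvgr _ _ _ _ (fun=> 0) (fun n => `|u n|)).
- move: ul; rewrite l0 => /cvgrPdist_lt/(_ _ ltr01); apply: filterS => n.
  rewrite sub0r normrN => un; rewrite powR_ge0 /=.
  have [->|un0] := eqVneq (u n) 0; first by rewrite normr0 powR0// gt_eqF.
  by apply: ge1r_powR => //; rewrite normr_gt0 un0 ltW.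
- exact: cvg_cst.
- by move: ul'; rewrite l0 normr0.
Qed.

Section Lp_space.
Context d (T : measurableType d) (R : realType).
Variables (mu : {measure set T -> \bar R}) (p : R) (p1 : (1 <= p%:E)%E).
Local Notation V := (LspaceType mu p1).

Let p_gt0 : 0 < p.
Proof. by rewrite (lt_le_trans ltr01)// -lee_fin. Qed.

Lemma Lspace_measurable (f : V) : measurable_fun setT (f : T -> R).
Proof. exact: (@measurable_funPT _ _ _ _ (Lrepr f)). Qed.

Lemma measurable_abs_powR (g : T -> R) : measurable_fun setT g ->
  measurable_fun setT (fun x => (`|g x| `^ p)%:E).
Proof.
move=> mg; apply/measurable_EFinP.
apply: (measurableT_comp (measurable_powR p)).
exact: measurableT_comp.
Qed.

Lemma Lspace_norm_powR (f : V) :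
  (`|f| `^ p)%:E = (\int[mu]_x (`|(f : T -> R) x| `^ p)%:E)%E.
Proof.
rewrite -poweR_EFin.
have -> : (`|f|)%:E = ('N[mu]_p%:E[EFin \o (f : T -> R)])%E.
  exact: (finite_norm_fine (Lrepr f)).
by rewrite powR_Lnorm// gt_eqF.
Qed.

Lemma Lspace_norm_le (f : V) c : 0 <= c ->
  (\int[mu]_x (`|(f : T -> R) x| `^ p)%:E <= (c `^ p)%:E)%E -> `|f| <= c.
Proof.
move=> c0; rewrite -Lspace_norm_powR lee_fin.
rewrite !leNgt; apply: contra => cf.
by apply: gt0_ltr_powR; rewrite ?nnegrE.
Qed.

Lemma Lspace_of_fun (g : T -> R) : measurable_fun setT g ->
  (\int[mu]_x (`|g x| `^ p)%:E < +oo)%E ->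
  exists f : V, (f : T -> R) = g %[ae mu].
Proof.
move=> mg gfin.
have gN : finite_norm mu p%:E g.
  rewrite /finite_norm unlock poweR_lty//.
have gL : g \in Lfun mu p%:E.
  by apply/andP; split; rewrite inE.
by exists (Lpi (Lfun_Sub p1 gL)); exact: LpiE.
Qed.

Let diffE (f g : V) :
  (fun x => (`|(f - g : V) x : R| `^ p)%:E) =
    (fun x => (`|(f x : R) - (g x : R)| `^ p)%:E) %[ae mu].
Proof.
have := Lspace_addE f (- g); apply: filterS2 (Lspace_oppE g) => x h1 h2.
by rewrite h2 h1.
Qed.

Let norm_diff (f g : V) :
  (`|f - g| `^ p)%:E = (\int[mu]_x (`|(f x : R) - (g x : R)| `^ p)%:E)%E.
Proof.
rewrite Lspace_norm_powR; apply: ae_eq_integral => //.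
- by apply: measurable_abs_powR; exact: Lspace_measurable.
- apply: measurable_abs_powR; apply: measurable_funB; exact: Lspace_measurable.
- by apply: filterS (diffE f g) => x ->.
Qed.

(** The series of the functions [h k], the powers of [2 ^+ k * |w k.+1 - w k|],
    has a finite integral. Almost everywhere its terms are therefore bounded,
    which makes [w k x] a Cauchy sequence; Fatou's lemma then bounds the
    distance from its limit to [w j]. *)
Lemma Lspace_fast_cvg (w : nat -> V) :
  (forall j i, `|w (j + i)%N - w j| <= 4^-1 ^+ j) ->
  exists g : V, forall j, `|g - w j| <= 4^-1 ^+ j.
Proof.
move=> hw.
pose h k x := ((2 ^+ k * `|(w k.+1 x : R) - (w k x : R)|) `^ p)%:E.
have mh k : measurable_fun setT (h k).
  apply/measurable_EFinP; apply: (measurableT_comp (measurable_powR p)).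
  apply: measurable_funM; first exact: measurable_cst.
  by apply: measurableT_comp => //; apply: measurable_funB;
    exact: Lspace_measurable.
have h0 k x : (0 <= h k x)%E by rewrite lee_fin powR_ge0.
have inth k : (\int[mu]_x h k x <= (2^-1 ^+ k)%:E)%E.
  have -> : (\int[mu]_x h k x = ((2 ^+ k) `^ p)%:E *
      \int[mu]_x (`|(w k.+1 x : R) - (w k x : R)| `^ p)%:E)%E.
    rewrite -ge0_integralZl//.
    - apply: eq_integral => x _; rewrite -EFinM /h -powRM//.
    - by apply: measurable_abs_powR; apply: measurable_funB;
      exact: Lspace_measurable.
  rewrite -norm_diff -EFinM lee_fin -powRM//.
  apply: (@le_trans _ _ ((2^-1 ^+ k) `^ p)).
    apply: ge0_ler_powR; rewrite ?nnegrE ?(ltW p_gt0)//.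
    have := hw k 1%N; rewrite addn1 => hwk.
    rewrite (_ : 2^-1 ^+ k = 2 ^+ k * 4^-1 ^+ k);
      first by rewrite ler_pM2l// exprn_gt0.
    by rewrite -exprMn; congr (_ ^+ _); field.
  rewrite ge1r_powR// ?exprn_gt0 ?invr_gt0//=.
  by rewrite exprn_ile1 ?invr_ge0// invf_le1// ler1n.
pose S x := (\sum_(k <oo) h k x)%E.
have S0 x : (0 <= S x)%E by apply: nneseries_ge0 => k _ _; exact: h0.
have mS : measurable_fun setT S by apply: ge0_emeasurable_sum.
have intS : mu.-integrable setT S.
  apply/integrableP; split => //.
  under eq_integral do rewrite gee0_abs//.
  rewrite integral_nneseries//; apply:
    (@le_lt_trans _ _ 2%:E); last exact: ltry.
  apply: (@le_trans _ _ (\sum_(k <oo) (2 / (2 ^ k.+1)%:R)%:E)%E).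
    apply: lee_nneseries => [k _ _|k _]; first exact: integral_ge0.
    apply: le_trans (inth k) _; rewrite lee_fin natrX exprS invfM mulrA divff//.
    by rewrite mul1r exprVn.
  exact: epsilon_trick0.
have cvg_ae : {ae mu, forall x, cvgn (fun k => w k x : R)}.
  have := integrable_ae measurableT intS; apply: filterS => x /(_ I) Sfin.
  pose s := fine (S x) `^ p^-1.
  have dk k : `|(w k.+1 x : R) - (w k x : R)| <= 2^-1 ^+ k * s.
    have : (h k x <= S x)%E.
      apply: le_trans (nneseries_lim_ge k.+1 _) => [|i _ _]; last exact: h0.
      rewrite (big_nat_recr k)//= leeDr//; apply: sume_ge0 => i _; exact: h0.
    rewrite -(fineK Sfin) lee_fin => hk.
    rewrite exprVn mulrC ler_pdivlMr ?exprn_gt0// mulrC.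
    rewrite /s; set a := leLHS; have {}hk : a `^ p <= fine (S x) by exact: hk.
    have -> : a = (a `^ p) `^ p^-1.
      by rewrite -powRrM divff ?gt_eqF// powRr1// mulr_ge0// exprn_ge0.
    by rewrite ge0_ler_powR ?invr_ge0 ?(ltW p_gt0)//
      nnegrE ?powR_ge0// fine_ge0.
  have dki k i : `|(w (k + i)%N x : R) - (w k x : R)| <=
    (2 * 2^-1 ^+ k - 2 * 2^-1 ^+ (k + i)) * s.
    elim: i => [|i IH]; first by rewrite addn0 !subrr normr0 mul0r.
    rewrite addnS -(subrKA (w (k + i)%N x : R)).
    apply: le_trans (ler_normD _ _) _.
    apply: (le_trans (lerD (dk _) IH)); rewrite -mulrDl exprS.
    by rewrite le_eqVlt; apply/orP; left; apply/eqP; field.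
  apply: cauchy_tail_cvgn => eps e0.
  have s0 : 0 <= s by exact: powR_ge0.
  have : 2 * s * 2^-1 ^+ j @[j --> \oo] --> (0 : R).
    rewrite -[X in _ --> X](mulr0 (2 * s)); apply: cvgMr.
    by apply: cvg_expr; rewrite gtr0_norm ?invr_gt0// invf_lt1// ltr1n.
  move=> /cvgrPdist_lt/(_ _ e0)[J _ /(_ J (leqnn J))].
  rewrite sub0r normrN => hJ; exists J => i; apply: le_lt_trans (dki J i) _.
  apply: le_lt_trans hJ; apply: le_trans (ler_norm _).
  rewrite mulrAC ler_wpM2r// lerBlDr lerDl mulr_ge0// exprn_ge0// invr_ge0//.
(* The upper limit is measurable everywhere, and the limit almost everywhere. *)
pose G x := fine (limn_esup (fun k => (w k x : R)%:E)).
have mG : measurable_fun setT G.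
  apply: measurableT_comp; first exact: fine_measurable.
  apply: measurable_fun_limn_esup => k; apply/measurable_EFinP.
  exact: Lspace_measurable.
have Glim : {ae mu, forall x, (w k x : R) @[k --> \oo] --> G x}.
  move: cvg_ae; apply: filterS => x wx; rewrite /G.
  have : (w k x : R)%:E @[k --> \oo] --> (limn (fun k => w k x : R))%:E.
    by apply: cvg_EFin; [exact: nearW|exact: wx].
  by move=> /cvg_limn_einf_sup[_ ->].
have intG j : (\int[mu]_x (`|G x - (w j x : R)| `^ p)%:E <=
  ((4^-1 ^+ j) `^ p)%:E)%E.
  pose F k x := (`|(w (j + k)%N x : R) - (w j x : R)| `^ p)%:E.
  have mF k : measurable_fun setT (F k).
    by apply: measurable_abs_powR; apply: measurable_funB;
      exact: Lspace_measurable.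
  have F0 k x : (0 <= F k x)%E by rewrite lee_fin powR_ge0.
  have -> : (\int[mu]_x (`|G x - (w j x : R)| `^ p)%:E =
      \int[mu]_x limn_einf (F^~ x))%E.
    apply: ge0_ae_eq_integral => //.
    - by apply: measurable_abs_powR; apply: measurable_funB => //;
      exact: Lspace_measurable.
    - rewrite /limn_einf; apply: measurableT_comp => //.
      by apply: measurable_fun_limn_esup => n; exact: measurableT_comp.
    - move=> x _; rewrite limn_einf_lim; apply: lime_ge;
      first exact: is_cvg_einfs.
      by apply: nearW => n; apply: le_ereal_inf_tmp => _ [k _ <-]; exact: F0.
    move: Glim; apply: filterS => x Gx _; apply/esym.
    have : F k x @[k --> \oo] --> (`|G x - (w j x : R)| `^ p)%:E.
      apply: cvg_EFin; first exact: nearW.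
      apply: cvg_abs_powR; first by rewrite -lee_fin.
      apply: cvgB; last exact: cvg_cst.
      have := Gx; rewrite -(cvg_shiftn j (fun k => w k x : R)).
      by under eq_fun do rewrite addnC.
    by move=> /cvg_limn_einf_sup[-> _].
  apply: le_trans (fatou mu measurableT mF (fun n x _ => F0 n x)) _.
  rewrite limn_einf_lim; apply: lime_le; first exact: is_cvg_einfs.
  apply: nearW => n; apply: (@le_trans _ _ (\int[mu]_x F n x)%E).
    apply: ereal_inf_lbound; exists n => //=; exact: leqnn.
  rewrite -norm_diff lee_fin ge0_ler_powR ?nnegrE ?(ltW p_gt0)//.
have [||f0 f0E] := @Lspace_of_fun (fun x => G x - (w 0%N x : R)).
- by apply: measurable_funB => //; exact: Lspace_measurable.
- by apply: le_lt_trans (intG 0%N) _; rewrite ltry.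
exists (f0 + w 0%N) => j; apply: Lspace_norm_le;
  first by rewrite exprn_ge0// invr_ge0.
apply: le_trans (intG j); rewrite le_eqVlt; apply/orP; left; apply/eqP.
apply: ae_eq_integral => //.
- by apply: measurable_abs_powR; exact: Lspace_measurable.
- by apply: measurable_abs_powR; apply: measurable_funB => //;
  exact: Lspace_measurable.
have h1 := diffE (f0 + w 0%N) (w j); have h2 :
  \forall x \ae mu, (f0 + w 0%N : V) x = (f0 x : R) + (w 0%N x : R) :> R.
  exact: (Lspace_addE f0 (w 0%N)).
move: f0E h1 h2; apply: filterS3 => x h3 h1 h2 _.
by rewrite (h1 I) h2 (h3 I) subrK.
Qed.

Lemma Lspace_complete (u : nat -> V) :
  (forall eps : R, 0 < eps -> exists N, forall i, `|u (N + i)%N - u N| < eps) ->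
  cvgn u.
Proof.
move=> hu.
have q0 k : (0 : R) < 4^-1 ^+ k / 2 by rewrite divr_gt0// exprn_gt0// invr_gt0.
have /choice[N hN] : forall k, exists N, forall i, `|u (N + i)%N
  - u N| < 4^-1 ^+ k / 2.
  by move=> k; exact: hu.
pose fix n k := if k is k'.+1 then maxn (n k') (N k) else N 0%N.
have Nn k : (N k <= n k)%N by case: k => //= k; rewrite leq_maxr.
have nS k i : (n k <= n (k + i))%N.
  by elim: i => [|i IH]; rewrite ?addn0// addnS (leq_trans IH)//= leq_maxl.
have hn k m : (n k <= m)%N -> `|u m - u (n k)| <= 4^-1 ^+ k.
  move=> km; have := hN k (m - N k)%N; have := hN k (n k - N k)%N.
  rewrite !subnKC ?(leq_trans (Nn k))// => h1 h2.
  rewrite -(subrKA (u (N k))) (le_trans (ler_normD _ _))//.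
  by rewrite (splitr (4^-1 ^+ k)) lerD// ?ltW// distrC.
have [|g hg] := @Lspace_fast_cvg (u \o n); first by move=> j i; exact: hn.
apply/cvg_ex; exists g; apply/cvgrPdist_lt => eps e0.
have : 2 * 4^-1 ^+ j @[j --> \oo] --> (0 : R).
  rewrite -[X in _ --> X](mulr0 2); apply: cvgMr.
  by apply: cvg_expr; rewrite gtr0_norm ?invr_gt0// invf_lt1// ltr1n.
move=> /cvgrPdist_lt/(_ _ e0)[k _ /(_ k (leqnn k))].
rewrite sub0r normrN => /(le_lt_trans (ler_norm _)) hk.
exists (n k) => // m /= km; apply: le_lt_trans hk.
rewrite -(subrKA (u (n k))) (le_trans (ler_normD _ _))//.
by rewrite mulr_natl mulr2n lerD//; [exact: hg|rewrite distrC hn].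
Qed.

End Lp_space.

(** * Copies of the space of square summable sequences *)

Section ell2_facts.
Context (R : realType).
Implicit Types f g : ell2 R.

Lemma counting_ae (P : nat -> Prop) :
  (\forall n \ae (counting : {measure set nat -> \bar R}), P n) -> forall n, P
    n.
Proof.
move=> [A [mA A0 PA]] n; apply: contrapT => nP.
have An : A n by exact: PA.
move: A0; apply/eqP; rewrite gt_eqF//; apply: (@lt_le_trans _ _ 1%E) => //.
rewrite -[X in (X <= _)%E](_ : counting [set n] = 1%E).
  by apply: le_measure; rewrite ?inE// => m ->.
rewrite /counting asboolT; last exact: finite_set1.
by rewrite fset_set1 finmap.cardfs1.
Qed.

Lemma ell2_linE a f g n : (a *: f + g : ell2 R) n = a *
  (f n : R) + (g n : R) :> R.
Proof.
have h1 := counting_ae (Lspace_addE (a *: f) g) n.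
have h2 := counting_ae (Lspace_scaleE a f) n.
have -> : (a *: f + g : ell2 R) n = ((a *: f : ell2 R) n : R) +
  (g n : R) :> R by exact: h1.
by congr (_ + _); exact: h2.
Qed.

Lemma ell2_norm f :
  series (fun n => (f n : R) ^+ 2) @ \oo --> `|f| ^+ 2.
Proof.
have := Lspace_norm_powR f; rewrite powR_mulrn//.
rewrite ge0_integral_count => [h|k]; last by rewrite lee_fin powR_ge0.
have h2 : (\sum_(k <oo) ((f k : R) ^+ 2)%:E = (`|f| ^+ 2)%:E)%E.
  rewrite h; apply: eq_eseriesr => k _.
  by rewrite powR_mulrn// real_normK// num_real.
have : (\sum_(0 <= k < n) ((f k : R) ^+ 2)%:E)%E
  @[n --> \oo] --> (`|f| ^+ 2)%:E.
  rewrite -h2; apply: is_cvg_nneseries => k _ _; rewrite lee_fin sqr_ge0//.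
move=> /fine_cvg; apply: cvg_trans; apply: near_eq_cvg; apply: nearW => n.
by rewrite /series /= sumEFin.
Qed.

Lemma ell2_partial_le f N : \sum_(0 <= n < N) (f n : R) ^+ 2 <= `|f| ^+ 2.
Proof.
have h := @ell2_norm f; rewrite -(cvg_lim _ h)//.
apply: (nondecreasing_cvgn_le (u_ := series _));
  last by apply/cvg_ex; eexists; exact: h.
by apply: nondecreasing_series => n _ _; exact: sqr_ge0.
Qed.

End ell2_facts.

Lemma sum_nat_tail (W : nmodType) (F : nat -> W) N i :
  \sum_(0 <= n < N + i) (if (N <= n)%N then F n else 0) =
    \sum_(N <= n < N + i) F n.
Proof.
rewrite (@big_cat_nat _ _ _ N)//= ?leq_addr// big_nat big1
  ?add0r => [|k /andP[_]].
  by apply: eq_big_nat => k /andP[->].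
by rewrite ltnNge => /negbTE ->.
Qed.

Section ell2_copy.
Context (R : realType) (V X : normedModType R) (T : {linear V -> X}).
Variables (B C c : R) (r : nat -> V).
Hypothesis complV : forall u : nat -> V,
  (forall eps : R, 0 < eps -> exists N, forall i, `|u (N + i)%N - u N| < eps) ->
  cvgn u.
Hypothesis C0 : 0 <= C.
Hypothesis c0 : 0 < c.
Hypothesis TB : forall x, `|T x| <= B * `|x|.
Hypothesis upper : forall N (a : nat -> R),
  `|\sum_(0 <= n < N) a n *: r n| ^+ 2 <= C * \sum_(0 <= n < N) a n ^+ 2.
Hypothesis lower : forall N (a : nat -> R),
  c * \sum_(0 <= n < N) a n ^+ 2 <= `|T (\sum_(0 <= n < N) a n *: r n)| ^+ 2.

Let part (a : ell2 R) N : V := \sum_(0 <= n < N) (a n : R) *: r n.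

Let part_cvg a : cvgn (part a).
Proof.
apply: complV => eps e0.
have /cvg_cauchy/cauchy_seriesP/(_ (eps ^+ 2 / (C + 1))) :
  cvgn (series (fun n => (a n : R) ^+ 2)).
  by apply/cvg_ex; eexists; exact: ell2_norm.
have C1 : 0 < C + 1 by rewrite ltr_wpDl.
case=> [|[P Q] /= [[m _ mP] [n _ nQ]] PQ];
  first by rewrite divr_gt0// exprn_gt0.
exists (maxn m n) => i; set N := maxn m n.
have := PQ (N, (N + i)%N)
  (conj (mP _ (leq_maxl _ _)) (nQ _ (leq_trans (leq_maxr _ _) (leq_addr _ _)))).
rewrite /= ger0_norm => [h|]; last by apply: sumr_ge0 => k _; exact: sqr_ge0.
rewrite -(@ltr_pXn2r _ 2) ?nnegrE ?(ltW e0)//.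
have := @upper (N + i) (fun k => if (N <= k)%N then a k : R else 0).
under eq_bigr do rewrite (fun_if (fun x => x *: _)) scale0r.
under [X in _ <= _ * X -> _]eq_bigr do rewrite
  (fun_if (fun x => x ^+ 2)) expr0n/=.
rewrite !sum_nat_tail => up.
have -> : part a (N + i) - part a N = \sum_(N <= n0 < N + i) (a n0 : R) *: r n0.
  by rewrite /part (@big_cat_nat _ _ _ N)//= ?leq_addr//
    [LHS]addrAC subrr add0r.
apply: le_lt_trans up _; move: h; rewrite ltr_pdivlMr// => h.
apply: le_lt_trans h; rewrite mulrC ler_wpM2l ?lerDl//.
by apply: sumr_ge0 => k _; exact: sqr_ge0.
Qed.

Let g (a : ell2 R) : V := limn (part a).

Let g_cvg a : part a @ \oo --> g a.
Proof. exact: part_cvg. Qed.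

Let g_lin k a b : g (k *: a + b) = k *: g a + g b.
Proof.
apply: cvg_lim => //.
have -> : part (k *: a + b) = (fun N => k *: part a N + part b N).
  apply/funext => N; rewrite /part scaler_sumr -big_split /=.
  by apply: eq_bigr => n _; rewrite ell2_linE scalerDl scalerA.
by apply: cvgD; [apply: cvgZr|]; exact: g_cvg.
Qed.

Let sqrtC := Num.sqrt C.
Let sqrtc := Num.sqrt c.

Let g_le a : `|g a| <= sqrtC * `|a|.
Proof.
apply: cvg_norm_le (@g_cvg a) _ => N.
rewrite -(@ler_pXn2r _ 2) ?nnegrE ?mulr_ge0 ?sqrtr_ge0// exprMn sqr_sqrtr//.
by apply: le_trans (upper N _) _; rewrite ler_wpM2l// ell2_partial_le.
Qed.

Let Tg_cvg a : T (part a N) @[N --> \oo] --> T (g a).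
Proof.
apply/cvgrPdist_lt => eps e0.
have B1 : 0 < `|B| + 1 by rewrite ltr_wpDl.
have /cvgrPdist_lt/(_ (eps / (`|B| + 1))) := @g_cvg a.
rewrite divr_gt0// => /(_ isT); apply: filterS => N.
rewrite ltr_pdivlMr// => h; rewrite -linearB; apply: le_lt_trans (TB _) _.
apply: le_lt_trans h; rewrite mulrC ler_wpM2l//.
by rewrite (le_trans (ler_norm _))// lerDl.
Qed.

Let Tg_ge a : sqrtc * `|a| <= `|T (g a)|.
Proof.
rewrite -(@ler_pXn2r _ 2) ?nnegrE ?mulr_ge0 ?sqrtr_ge0//
  exprMn sqr_sqrtr ?(ltW c0)//.
have h1 : c * series (fun n => (a n : R) ^+ 2) N @[N --> \oo] --> c * `|a| ^+ 2.
  by apply: cvgMr; exact: ell2_norm.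
have h2 : `|T (part a N)| ^+ 2 @[N --> \oo] --> `|T (g a)| ^+ 2.
  by rewrite expr2; under eq_fun do rewrite expr2; apply: cvgM; apply:
    cvg_norm; exact: Tg_cvg.
rewrite -(cvg_lim _ h1)// -(cvg_lim _ h2)//.
apply: ler_lim; [by apply/cvg_ex; eexists; exact:
  h1|by apply/cvg_ex; eexists; exact: h2|].
by apply: nearW => N; exact: lower.
Qed.

Let sqrtc_gt0 : 0 < sqrtc. Proof. by rewrite sqrtr_gt0. Qed.

Let g0 : g 0 = 0.
Proof. by apply/normr0_eq0/eqP; rewrite eq_le normr_ge0 andbT
  (le_trans (g_le 0))// normr0 mulr0. Qed.

Let gB a b : g a - g b = g (a - b).
Proof. by rewrite -[in RHS]scaleN1r [in RHS]addrC g_lin scaleN1r addrC. Qed.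

Let g_inj a b : g a = g b -> a = b.
Proof.
move=> gab; apply/eqP; rewrite -subr_eq0 -normr_le0.
rewrite -(@ler_pM2l _ sqrtc)// mulr0.
by rewrite (le_trans (Tg_ge _))// -gB gab subrr linear0 normr0.
Qed.

Let g_closed : closed (range g).
Proof.
move=> x hx.
have /choice[a ha] : forall n, exists a : ell2 R, `|x - g a| < n.+1%:R^-1.
  move=> n; have n0 : (0 : R) < n.+1%:R^-1 by rewrite invr_gt0.
  have [_ [[a _ <-]]] := hx _ (nbhsx_ballx x _ n0).
  by rewrite -ball_normE /ball_ /= => xa; exists a.
have gax : g (a n) @[n --> \oo] --> x.
  apply/cvgrPdist_lt => eps e0; near=> n.
  apply: lt_trans (ha n) _; near: n; exact: near_infty_natSinv_lt (PosNum e0).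
have acvg : cvgn a.
  apply: Lspace_complete => eps e0.
  pose e1 := sqrtc * eps / (`|B| + 1) / 2.
  have B1 : 0 < `|B| + 1 by rewrite ltr_wpDl.
  have e10 : 0 < e1 by rewrite !divr_gt0// mulr_gt0.
  have /cvgrPdist_lt/(_ _ e10)[N _ hN] := gax.
  exists N => i; rewrite -(@ltr_pM2l _ sqrtc)//.
  apply: le_lt_trans (Tg_ge _) _; rewrite -gB.
  apply: le_lt_trans (TB _) _; apply:
    (@le_lt_trans _ _ ((`|B| + 1) * `|g (a (N + i)%N) - g (a N)|)).
    by rewrite ler_wpM2r// (le_trans (ler_norm _))// lerDl.
  rewrite mulrC -ltr_pdivlMr//.
  rewrite -(subrKA x) (le_lt_trans (ler_normD _ _))//.
  rewrite (splitr (_ / _)) -/e1 ltrD//; last exact: (hN N (leqnn N)).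
  by rewrite distrC; apply: hN => /=; rewrite leq_addr.
exists (limn a) => //.
have gal : g (a n) @[n --> \oo] --> g (limn a).
  apply/cvgrPdist_lt => eps e0.
  have C1 : 0 < sqrtC + 1 by rewrite ltr_wpDl// sqrtr_ge0.
  have /cvgrPdist_lt/(_ (eps / (sqrtC + 1))) :
    a @ \oo --> limn a by exact: acvg.
  rewrite divr_gt0// => /(_ isT); apply: filterS => n.
  rewrite ltr_pdivlMr// gB => h; apply: le_lt_trans (g_le _) _.
  by apply: le_lt_trans h; rewrite mulrC ler_wpM2l// lerDl.
by rewrite -(cvg_lim _ gal)// (cvg_lim _ gax).
Unshelve. all: by end_near. Qed.

(** The map [a |-> \sum_n a n *: r n] is bounded, and it is bounded below even
    after composition with [T]; so [T] is an isomorphism on its range, which is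
    closed because [ell2] is complete. *)
Theorem not_strictly_singular_of_ell2 : ~ strictly_singular (ell2 R) T.
Proof.
pose H := range g; pose f (x : V) : ell2 R := xget 0 [set a | g a = x].
have fg a : f (g a) = a by apply: g_inj; exact:
  (@xgetI _ _ [set b | g b = g a] a).
have bound_T u : H u -> `|u| <= sqrtC / sqrtc * `|T u|.
  move=> [a _ <-]; apply: le_trans (g_le a) _;
    rewrite -mulrA ler_wpM2l ?sqrtr_ge0//.
  by rewrite mulrC ler_pdivlMr// mulrC; exact: Tg_ge.
move=> /(_ H); apply.
- split=> [|k u v]; first by apply: mem_set; exists 0.
  move=> /(@set_mem _ H _)[a _ <-] /(@set_mem _ H _)[b _ <-];
    apply: (@mem_set _ H _).
  by exists (k *: a + b) => //; rewrite g_lin.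
- exact: g_closed.
- exists f; split.
  + by move=> k u v /set_mem[a _ <-] /set_mem[b _ <-]; rewrite -g_lin !fg.
  + exists (`|B| / sqrtc) => _ /set_mem[a _ <-];
    rewrite fg mulrAC ler_pdivlMr// mulrC.
    apply: le_trans (Tg_ge a) _; apply: le_trans (TB _) _.
    by rewrite ler_wpM2r// ler_norm.
  + exists g; split=> //.
    * by exists sqrtC => a _; exact: g_le.
    * by move=> a _; exists a.
    * by move=> _ /set_mem[a _ <-]; rewrite fg.
- split.
  + by move=> k u v _ _; rewrite linearP.
  + by exists B => u _; exact: TB.
  + pose h (y : X) : V := xget 0 [set u | H u /\ T u = y].
    have hT u : H u -> H (h (T u)) /\ T (h (T u)) = T u.
      by move=> Hu; exact: (@xgetI _ _
        [set v | H v /\ T v = T u] u (conj Hu erefl)).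
    exists h; split.
    * exists (sqrtC / sqrtc) => _ /set_mem[u Hu <-].
      by have [Hv Tv] := hT u Hu;
        rewrite -[X in _ <= _ * `|X|]Tv; exact: bound_T.
    * by move=> u Hu; exists u.
    * by move=> _ [u /hT[Hu _] <-].
    * move=> u /set_mem Hu; have [Hv Tv] := hT u Hu; apply/eqP;
      rewrite -subr_eq0 -normr_le0.
      rewrite (le_trans (bound_T _ _))//;
        last by rewrite linearB Tv subrr normr0 mulr0.
      case: Hv Hu => [a _ <-] [b _ <-]; exists (a - b) => //; by rewrite gB.
    * by move=> _ /set_mem[u Hu <-]; have [] := hT u Hu.
Qed.

End ell2_copy.

(** * Signed walks on binary words *)

(** Words record a path in the binary tree with the latest bit first, so that
    [b :: w] is a child of [w]. *)
Fixpoint words n : seq (seq bool) :=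
  if n is m.+1 then map (cons true) (words m) ++ map (cons false) (words m)
  else [:: [::]].

Lemma mem_words n w : (w \in words n) = (size w == n).
Proof.
elim: n w => [|n IH] [|b w] //=; rewrite mem_cat.
  by apply/norP; split; apply/mapP => -[].
rewrite eqSS -IH; apply/orP/idP.
  by case=> /mapP[v vn [_ ->]].
by move=> wn; case: b; [left|right]; exact: map_f.
Qed.

Lemma words_uniq n : uniq (words n).
Proof.
elim: n => //= n IH; rewrite cat_uniq !map_inj_uniq ?IH//; try by move=> ? ? [].
by rewrite andbT /=; apply/hasPn => _ /mapP[v _ ->]; apply/mapP => -[].
Qed.

Lemma sum_wordsS (W : nmodType) n (F : seq bool -> W) :
  \sum_(w <- words n.+1) F w = \sum_(w <- words n)
    (F (true :: w) + F (false :: w)).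
Proof. by rewrite big_cat !big_map big_split. Qed.

Section averages.
Context (R : realType).
Implicit Types (F G : seq bool -> R) (a : nat -> R).

Definition avg n F : R := 2^-1 ^+ n * \sum_(w <- words n) F w.

Lemma avgS n F : avg n.+1 F = avg n
  (fun w => (F (true :: w) + F (false :: w)) / 2).
Proof. by rewrite /avg sum_wordsS exprSr -mulrA -mulr_suml [_ / 2]mulrC. Qed.

Lemma eq_avg n F G : (forall w, size w = n -> F w = G w) -> avg n F = avg n G.
Proof.
move=> FG; congr (_ * _); apply: eq_big_seq => w.
by rewrite mem_words => /eqP /FG.
Qed.

Lemma le_avg n F G : (forall w, size w = n -> F w <= G w) -> avg n F <= avg n G.
Proof.
move=> FG; rewrite /avg ler_wpM2l ?exprn_ge0 ?invr_ge0// !big_seq.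
by apply: ler_sum => w; rewrite mem_words => /eqP /FG.
Qed.

Lemma avgD n F G : avg n (fun w => F w + G w) = avg n F + avg n G.
Proof. by rewrite /avg big_split mulrDr. Qed.

Lemma avgZ n k F : avg n (fun w => k * F w) = k * avg n F.
Proof. by rewrite /avg -mulr_sumr mulrCA. Qed.

Lemma avg_cst n k : avg n (fun=> k) = k.
Proof.
elim: n => [|n IH]; first by rewrite /avg /= big_seq1 expr0 mul1r.
by rewrite avgS mulrDl -splitr.
Qed.

Lemma avg_behead n F : avg n.+1 (fun w => F (behead w)) = avg n F.
Proof. by rewrite avgS; apply: eq_avg => w _ /=; rewrite mulrDl -splitr. Qed.

Definition sgb (b : bool) : R := if b then 1 else -1.

Fixpoint walk a w : R :=
  if w is b :: w' then walk a w' + sgb b * a (size w') else 0.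

Lemma walkZ k a w : walk (fun n => k * a n) w = k * walk a w.
Proof. by elim: w => [|b w IH] /=; rewrite ?mulr0// IH mulrDr (mulrCA k). Qed.

Lemma cosh_le (x : R) : `|x| <= 1 / 2 -> (expR x + expR (- x)) /
  2 <= expR (2 * x ^+ 2).
Proof.
have expR_le (y : R) : `|y| <= 1 / 2 -> expR y <= 1 + y + 2 * y ^+ 2.
  move=> /ler_normlP[y1 y2]; have h := expR_ge1Dx (- y).
  have e0 : 0 < 1 - y by lra.
  rewrite -[y in expR y]opprK expRN; apply: (@le_trans _ _ (1 - y)^-1).
    by rewrite lef_pV2 ?posrE ?expR_gt0.
  rewrite -div1r ler_pdivrMr//.
  rewrite -subr_ge0 (_ : _ - 1 = y ^+ 2 * (1 - 2 * y)); last by ring.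
  by rewrite mulr_ge0 ?sqr_ge0//; lra.
move=> x2; apply: le_trans (expR_ge1Dx _).
rewrite ler_pdivrMr//.
have h1 := expR_le x x2; have := expR_le (- x);
  rewrite normrN sqrrN => /(_ x2) h2.
by lra.
Qed.

Lemma avg_exp_walk n a : (forall i, (i < n)%N -> `|a i| <= 1 / 2) ->
  avg n (fun w => expR (walk a w)) <= expR (2 * \sum_(0 <= i < n) a i ^+ 2).
Proof.
elim: n => [|n IH] an.
  by rewrite big_geq// mulr0 expR0 /avg big_seq1 /= expR0 mulr1.
rewrite avgS big_nat_recr//= mulrDr expRD.
rewrite (@eq_avg _ _ (fun w => (expR (a n) + expR (- a n))
  / 2 * expR (walk a w))).
  rewrite avgZ mulrC; apply: ler_pM.
  - by rewrite /avg mulr_ge0 ?exprn_ge0 ?invr_ge0// sumr_ge0//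
    => w _; exact: expR_ge0.
  - by rewrite divr_ge0// addr_ge0// expR_ge0.
  - by apply: IH => i ni; apply: an; rewrite ltnW.
  - by apply: cosh_le; exact: an.
by move=> w wn; rewrite wn !expRD !mul1r !mulN1r; field.
Qed.

Lemma powR_le_exp (p x : R) : 0 < p -> `|x| `^ p <= p `^ p
  * (expR x + expR (- x)).
Proof.
move=> p0; apply: (@le_trans _ _ (p `^ p * expR `|x|)); last first.
  rewrite ler_wpM2l ?powR_ge0//; case: (ler0P x) => _.
    by rewrite lerDr expR_ge0.
  by rewrite lerDl expR_ge0.
have -> : expR `|x| = expR (`|x| / p) `^ p.
  by rewrite /powR gt_eqF ?expR_gt0// expRK mulrC divfK ?gt_eqF.
rewrite -powRM ?expR_ge0 ?(ltW p0)//; apply: ge0_ler_powR;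
  rewrite ?nnegrE ?(ltW p0)//.
  by rewrite mulr_ge0 ?expR_ge0 ?ltW.
rewrite mulrC -ler_pdivrMr//; apply: le_trans (expR_ge1Dx _).
by rewrite lerDr.
Qed.

(** The exponential moment of the walk is at most [expR (2 * \sum_i a i ^+ 2)],
    and [powR_le_exp] bounds the power moments by exponential ones. *)
Lemma khintchine (p : R) n a : 0 < p -> \sum_(0 <= i < n) a i ^+ 2 <= 1 / 4 ->
  avg n (fun w => `|walk a w| `^ p) <= p `^ p * (2 * expR 1).
Proof.
move=> p0 a4.
have an i : (i < n)%N -> `|a i| <= 1 / 2.
  move=> ni; rewrite -(@ler_pXn2r _ 2) ?nnegrE// ?divr_ge0//
    real_normK ?num_real//.
  rewrite (_ : (1 / 2) ^+ 2 = 1 / 4); last by field.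
  apply: le_trans a4; rewrite big_mkord (bigD1 (Ordinal ni))//= lerDl.
  by apply: sumr_ge0 => *; exact: sqr_ge0.
apply: (@le_trans _ _
  (avg n (fun w => p `^ p *
    (expR (walk a w) + expR (walk (fun i => -1 * a i) w))))).
  by apply: le_avg => w _; rewrite walkZ mulN1r; exact: powR_le_exp.
rewrite avgZ avgD ler_wpM2l ?powR_ge0// mulr_natl mulr2n lerD//.
  apply: le_trans (avg_exp_walk an) _; rewrite ler_expR; lra.
apply: le_trans (avg_exp_walk _) _ => [i ni|];
  first by rewrite mulN1r normrN an.
rewrite ler_expR; under eq_bigr do rewrite mulN1r sqrrN.
lra.
Qed.

Fixpoint stopped a w : R :=
  if w is b :: w' then
    if 1 <= `|stopped a w'| then stopped a w'
    else stopped a w' + sgb b * a (size w')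
  else 0.

Definition alive a w : bool := `|stopped a w| < 1.

Lemma stopped_le a alpha n w :
  0 <= alpha -> (forall i, (i < n)%N -> `|a i| <= alpha) ->
  (size w <= n)%N -> `|stopped a w| <= 1 + alpha.
Proof.
move=> al0 ha; elim: w => [|b w IH] /= wn; first by rewrite normr0 addr_ge0.
have [h|/ltW h] := leP 1 `|stopped a w|; first exact/IH/ltnW.
apply: le_trans (ler_normD _ _) _; apply: lerD => //.
by rewrite normrM /sgb; case: b; rewrite ?normrN normr1 mul1r ha.
Qed.

Lemma avg_alive_decr a n :
  avg n.+1 (fun w => (alive a w)%:R) <= avg n (fun w => (alive a w)%:R).
Proof.
rewrite avgS; apply: le_avg => w _; rewrite /alive /=.
have [h|h] := leP 1 `|stopped a w|; first by rewrite ltNge h /= addr0 mul0r.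
rewrite ler_pdivrMr// mul1r.
by case: (_ < 1); case: (_ < 1) => /=; lra.
Qed.

(** Each step adds [a n ^+ 2] to the second moment on the surviving paths, and
    the proportion of surviving paths decreases. *)
Lemma stopped_second_moment a n :
  (\sum_(0 <= i < n) a i ^+ 2) * avg n (fun w => (alive a w)%:R)
  <= avg n (fun w => stopped a w ^+ 2).
Proof.
elim: n => [|n IH].
  by rewrite big_geq// mul0r /avg big_seq1 /= expr0n /= mulr0.
rewrite big_nat_recr//=.
apply: (@le_trans _ _ ((\sum_(0 <= i < n) a i ^+ 2 + a n ^+ 2) * avg n
  (fun w => (alive a w)%:R))).
  rewrite ler_wpM2l ?avg_alive_decr// addr_ge0 ?sqr_ge0//.
  by apply: sumr_ge0 => *; exact: sqr_ge0.
rewrite mulrDl; apply: le_trans (lerD IH (lexx _)) _.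
rewrite -avgZ -avgD avgS; apply: le_avg => w wn; rewrite /alive /= wn.
have [h|h] := leP 1 `|stopped a w|; first by rewrite mulr0; lra.
rewrite mulr1 /sgb /= mul1r mulN1r !sqrrD.
by rewrite -subr_ge0; set x := (X in 0 <= X); rewrite (_ : x = 0)// /x; field.
Qed.

Lemma avg_alive_le a alpha n s : 0 <= alpha <= 1 ->
  (forall i, (i < n)%N -> `|a i| <= alpha) -> 0 < s ->
  \sum_(0 <= i < n) a i ^+ 2 = s ->
  avg n (fun w => (alive a w)%:R) <= 4 / s.
Proof.
move=> /andP[al0 al1] ha s0 hs; rewrite ler_pdivlMr// mulrC -hs.
apply: le_trans (stopped_second_moment a n) _.
rewrite -[leRHS](avg_cst n); apply: le_avg => w wn.
have h := stopped_le al0 ha (eq_leq wn).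
rewrite -[leLHS]real_normK ?num_real// (_ : 4 = 2 ^+ 2); last by ring.
by rewrite ler_pXn2r ?nnegrE//; lra.
Qed.

Lemma stopped_flip a w : stopped a (map negb w) = - stopped a w.
Proof.
elim: w => [|b w IH] /=; first by rewrite oppr0.
rewrite IH normrN size_map; case: ifP => // _.
by rewrite opprD; congr (_ + _); case: b; rewrite /sgb /= ?mul1r ?mulN1r ?opprK.
Qed.

Lemma sum_words_flip (W : nmodType) n (F : seq bool -> W) :
  \sum_(w <- words n) F (map negb w) = \sum_(w <- words n) F w.
Proof.
elim: n F => [|n IH] F; first by rewrite !big_seq1.
rewrite !sum_wordsS /= [LHS]big_split [RHS]big_split /= addrC.
by congr (_ + _); [exact: (IH (fun w => F (true :: w)))|exact:
  (IH (fun w => F (false :: w)))].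
Qed.

(** On the paths that survive, the head of the word is used as one more
    independent sign; this keeps the function symmetric. *)
Definition exit_sign a w : R :=
  if alive a (behead w) then sgb (head true w)
  else Num.sg (stopped a (behead w)).

Lemma exit_sign_sqr a w : exit_sign a w ^+ 2 = 1.
Proof.
rewrite /exit_sign /alive; case: ltP => h; last first.
  by rewrite sqr_sg -normr_gt0 (lt_le_trans ltr01 h).
by rewrite /sgb; case: head; rewrite ?sqrrN expr1n.
Qed.

(** Flipping all the bits changes the sign of the stopped walk. *)
Lemma sum_exit_sign a n : \sum_(w <- words n.+1) exit_sign a w = 0.
Proof.
rewrite sum_wordsS.
pose F w : R := if alive a w then 0 else 2 * Num.sg (stopped a w).
rewrite (eq_bigr F) => [|w _]; last first.
  by rewrite /exit_sign /F /=; case: ifP => _;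
    rewrite ?subrr// mulr_natl mulr2n.
have : \sum_(w <- words n) F w = - \sum_(w <- words n) F w.
  rewrite -{1}sum_words_flip -sumrN; apply: eq_bigr => w _.
  by rewrite /F /alive stopped_flip normrN; case: ifP => _;
    rewrite ?oppr0// sgrN mulrN.
by set x := \sum_(w <- _) _; lra.
Qed.

Lemma avg_stopped_exit a alpha (p : R) n : 0 < p -> 0 <= alpha ->
  (forall i, (i < n)%N -> `|a i| <= alpha) ->
  avg n.+1 (fun w => `|stopped a (behead w) - exit_sign a w| `^ p)
  <= alpha `^ p + 2 `^ p * avg n (fun w => (alive a w)%:R).
Proof.
move=> p0 al0 ha; rewrite -avgZ -(avg_behead n (fun w => _ * _)).
rewrite -[X in X + _](avg_cst n.+1) -avgD; apply: le_avg => w wn.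
rewrite /exit_sign; have := @stopped_le a alpha n (behead w) al0 ha.
rewrite size_behead wn /= => /(_ (leqnn _)).
rewrite /alive; set x := stopped a _ => x1; case: ltP => h /=.
  rewrite mulr1 -[leLHS]add0r lerD ?powR_ge0//; apply: ge0_ler_powR;
    rewrite ?nnegrE ?(ltW p0)//.
  apply: le_trans (ler_normB _ _) _.
  by rewrite /sgb; case: head; rewrite ?normrN normr1; lra.
rewrite mulr0 addr0; apply: ge0_ler_powR; rewrite ?nnegrE ?(ltW p0)//.
rewrite {1}(numEsg x) -[X in _ - X]mulr1 -mulrBr normrM.
have -> : `|Num.sg x| = 1 by rewrite normr_sg -normr_gt0 (lt_le_trans ltr01 h).
by rewrite mul1r ger0_norm; lra.
Qed.

End averages.

(** * Dyadic trees of measurable sets *)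

Section trees.
Context d (T : measurableType d) (R : realType).
Variables (mu : {measure set T -> \bar R}) (p : R) (p1 : (1 <= p%:E)%E).
Local Notation V := (LspaceType mu p1).

Let p_gt0 : 0 < p.
Proof. by rewrite (lt_le_trans ltr01)// -lee_fin. Qed.

Definition indL (A : set T) : V :=
  xget 0 [set f : V | \forall x \ae mu, (f x : R) = \1_A x].

Lemma indLE A : measurable A -> (mu A < +oo)%E ->
  \forall x \ae mu, (indL A x : R) = \1_A x.
Proof.
move=> mA Afin.
have [f fE] : exists f : V, \forall x \ae mu, (f x : R) = \1_A x.
  have [||f fE] := @Lspace_of_fun _ _ _ mu p p1 (\1_A : T -> R).
  - exact: measurable_indic.
  - apply: le_lt_trans Afin.
    have -> : mu A = (\int[mu]_x (\1_A x)%:E)%E by rewrite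
      integral_indic// setIT.
    apply: ge0_le_integral => //.
    + apply: measurable_abs_powR; exact: measurable_indic.
    + by apply/measurable_EFinP; exact: measurable_indic.
    + move=> x _; rewrite lee_fin indicE; case: (x \in A);
      rewrite ?normr1 ?powR1//.
      by rewrite normr0 powR0// gt_eqF.
  - by exists f; apply: filterS fE => x; apply.
exact: (@xgetI _ _ [set f : V | \forall x \ae mu, (f x : R) = \1_A x] f).
Qed.

Lemma Lspace_eq_ae (f g : V) : (\forall x \ae mu, (f x : R) = g x) -> f = g.
Proof. by move=> fg; apply/Lspace_eqP; apply: filterS fg => x ->. Qed.

Lemma Lspace_scale_addE k (f g : V) :
  \forall x \ae mu, ((k *: f + g : V) x : R) = k * (f x : R) + (g x : R).
Proof.
have h1 : \forall x \ae mu, ((k *: f + g : V) x : R) =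
  ((k *: f : V) x : R) + (g x : R).
  exact: (Lspace_addE (k *: f) g).
have h2 : \forall x \ae mu, ((k *: f : V) x : R) = k * (f x : R).
  exact: (Lspace_scaleE k f).
by move: h1 h2; apply: filterS2 => x -> ->.
Qed.

Lemma Lspace_zero_ae : \forall x \ae mu, ((0 : V) x : R) = 0.
Proof. exact: (Lspace_zeroE mu p1). Qed.

Lemma Lspace_sumE (I : Type) (s : seq I) (k : I -> R)
  (F : I -> V) (f : I -> T -> R) :
  (forall i, \forall x \ae mu, (F i x : R) = f i x) ->
  \forall x \ae mu, ((\sum_(i <- s) k i *: F i : V) x : R) =
    \sum_(i <- s) k i * f i x.
Proof.
move=> Ff; elim: s => [|i s IH].
  by rewrite big_nil; apply: filterS Lspace_zero_ae => x ->; rewrite big_nil.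
rewrite big_cons; move:
  (Lspace_scale_addE (k i) (F i) (\sum_(i <- s) k i *: F i)) (Ff i) IH.
by apply: filterS3 => x -> -> ->; rewrite big_cons.
Qed.

Record tree (m : R) (cell : seq bool -> set T) : Prop := {
  tree_meas : forall w, measurable (cell w) ;
  tree_split : forall w, cell w = cell (true :: w) `|` cell (false :: w) ;
  tree_disj : forall w, cell (true :: w) `&` cell (false :: w) = set0 ;
  tree_mu : forall w, mu (cell w) = (m * 2^-1 ^+ size w)%:E }.

Section one_tree.
Variables (m : R) (cell : seq bool -> set T).
Hypothesis tr : tree m cell.

Lemma cell_sub w : cell w `<=` cell [::].
Proof.
elim: w => [//|b w IH] x xw; apply: IH; rewrite (tree_split tr w).
by case: b xw; [left|right].
Qed.

Lemma cell_path n x : cell [::] x ->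
  exists2 v, size v = n & forall w, size w = n -> (x \in cell w) = (w == v).
Proof.
move=> x0; elim: n => [|n [v vn IH]].
  by exists [::] => // -[|//] _; rewrite mem_set.
have : x \in cell v by rewrite IH ?eqxx.
have dis w : ~ (cell (true :: w) x /\ cell (false :: w) x).
  by move=> h; have := tree_disj tr w; rewrite -subset0 => /(_ x h).
have sub b w : x \in cell (b :: w) -> x \in cell w.
  rewrite !inE (tree_split tr w); case: b; [by left|by right].
rewrite inE (tree_split tr v) => xv.
have [b xb] : exists b, cell (b :: v) x by case: xv; [exists true|exists false].
exists (b :: v) => [|[//|c w] [wn]] /=; first by rewrite vn.
apply/idP/eqP => [xw|[-> ->]]; last exact: mem_set.
have /eqP wv : w == v by rewrite -IH//; exact: sub xw.
move: xw; rewrite wv inE => xc; congr (_ :: _).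
by case: b c xb xc => -[]// xb xc; case: (dis v).
Qed.

Definition stepf n (phi : seq bool -> R) (x : T) : R :=
  \sum_(w <- words n) phi w * \1_(cell w) x.

Lemma stepf_in n x : cell [::] x ->
  exists2 v, size v = n & forall phi, stepf n phi x = phi v.
Proof.
move=> /(cell_path n)[v vn hv]; exists v => // psi.
rewrite /stepf (bigD1_seq v) ?words_uniq ?mem_words ?vn//=
  big1_seq => [|w /andP[wv]].
  by rewrite addr0 indicE hv// eqxx mulr1.
by rewrite mem_words => /eqP wn; rewrite indicE hv// (negbTE wv) mulr0.
Qed.

Lemma stepf_out n phi x : ~ cell [::] x -> stepf n phi x = 0.
Proof.
move=> x0; apply: big1 => w _; rewrite indicE memNset ?mulr0//.
by move=> /cell_sub.
Qed.

(** At most one cell of each level contains [x]. *)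
Lemma stepf_comp n phi (G : R -> R) x : G 0 = 0 ->
  G (stepf n phi x) = stepf n (G \o phi) x.
Proof.
move=> G0; have [/(stepf_in n)[v _ hv]|x0] := pselect (cell [::] x).
  by rewrite !hv.
by rewrite !stepf_out.
Qed.

Lemma measurable_stepf n phi : measurable_fun setT (stepf n phi).
Proof.
apply: measurable_sum => w; apply: measurable_funM => //.
by apply: measurable_indic; exact: (tree_meas tr).
Qed.

Lemma integral_stepf_ge0 n phi : (forall w, 0 <= phi w) ->
  (\int[mu]_x (stepf n phi x)%:E = (m * avg n phi)%:E)%E.
Proof.
move=> phi0; under eq_integral do rewrite -sumEFin.
rewrite ge0_integral_sum//; last 2 first.
- move=> w; apply/measurable_EFinP; apply: measurable_funM => //.
  by apply: measurable_indic; exact: (tree_meas tr).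
- by move=> w x _; rewrite lee_fin mulr_ge0.
rewrite /avg mulrA mulr_sumr -sumEFin; apply: eq_big_seq => w.
rewrite mem_words => /eqP wn.
under eq_integral do rewrite EFinM.
rewrite ge0_integralZl//; last 2 first.
- by apply/measurable_EFinP; apply: measurable_indic; exact: (tree_meas tr).
- by rewrite lee_fin.
rewrite integral_indic//; last exact: (tree_meas tr).
by rewrite setIT (tree_mu tr) wn -EFinM mulrC.
Qed.

Lemma integral_stepf n phi :
  (\int[mu]_x (stepf n phi x)%:E = (m * avg n phi)%:E)%E.
Proof.
rewrite integralE.
have -> : (\int[mu]_x ((fun x => (stepf n phi x)%:E)^\+ x) =
    (m * avg n (fun w => Num.max (phi w) 0))%:E)%E.
  rewrite -integral_stepf_ge0 => [|w]; last by rewrite le_max lexx orbT.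
  apply: eq_integral => x _; rewrite funeposE -EFin_max; congr (_%:E).
  by rewrite (@stepf_comp n phi (fun y => Num.max y 0))// maxxx.
have -> : (\int[mu]_x ((fun x => (stepf n phi x)%:E)^\- x) =
    (m * avg n (fun w => Num.max (- phi w) 0))%:E)%E.
  rewrite -integral_stepf_ge0 => [|w]; last by rewrite le_max lexx orbT.
  apply: eq_integral => x _; rewrite funenegE -EFinN -EFin_max; congr (_%:E).
  by rewrite (@stepf_comp n phi (fun y => Num.max (- y) 0))// oppr0 maxxx.
rewrite -EFinB; congr (_%:E); rewrite -mulrBr; congr (_ * _).
rewrite -[avg n (fun w => Num.max (- phi w) 0)]mul1r -mulNr -avgZ -avgD.
apply: eq_avg => w _; rewrite mulN1r /Num.max oppr_lt0.
by case: (ltrgt0P (phi w)) => h; rewrite ?subr0 ?sub0r ?opprK ?h ?oppr0 ?addr0.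
Qed.

Definition stepL n (phi : seq bool -> R) :
  V := \sum_(w <- words n) phi w *: indL (cell w).

Let cell_fin w : (mu (cell w) < +oo)%E.
Proof. by rewrite (tree_mu tr) ltry. Qed.

Lemma stepLE n phi : \forall x \ae mu, (stepL n phi x : R) = stepf n phi x.
Proof. by apply: Lspace_sumE => w; apply: indLE => //;
  exact: (tree_meas tr). Qed.

Lemma stepL_norm n phi : `|stepL n phi| `^ p = m * avg n
  (fun w => `|phi w| `^ p).
Proof.
apply: EFin_inj; rewrite Lspace_norm_powR -integral_stepf_ge0;
  last by move=> w; exact: powR_ge0.
apply: ae_eq_integral => //.
- by apply: measurable_abs_powR; exact: Lspace_measurable.
- by apply/measurable_EFinP; exact: measurable_stepf.
apply: filterS (stepLE n phi) => x -> _; congr (_%:E).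
by rewrite (@stepf_comp n phi (fun y => `|y| `^ p))// normr0 powR0// gt_eqF.
Qed.

Lemma stepL_linear n k phi psi :
  stepL n (fun w => k * phi w + psi w) = k *: stepL n phi + stepL n psi.
Proof.
rewrite /stepL scaler_sumr -big_split /=.
by apply: eq_bigr => w _; rewrite scalerDl scalerA.
Qed.

Lemma eq_stepL n phi psi : (forall w, size w = n -> phi w = psi w) ->
  stepL n phi = stepL n psi.
Proof.
by move=> e; apply: eq_big_seq => w; rewrite mem_words => /eqP /e ->.
Qed.

Lemma indL_split w : indL (cell w) = indL (cell (true :: w)) +
  indL (cell (false :: w)).
Proof.
apply: Lspace_eq_ae.
have hi v := indLE (tree_meas tr v) (cell_fin v).
have := Lspace_scale_addE 1 (indL (cell (true :: w)))
  (indL (cell (false :: w))).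
rewrite scale1r; move: (hi w) (hi (true :: w)) (hi (false :: w)).
move=> h; move=> /(filterI h){h}; apply: filterS3 => x [-> h1] h2 ->;
  rewrite h1 h2 mul1r (tree_split tr w).
rewrite !indicE in_setU; case: (boolP (x \in cell (true :: w))) =>
  x1; last by rewrite add0r.
by rewrite memNset ?addr0// => x2; rewrite -[False]/(set0 x) -(tree_disj tr w);
  split => //; exact: set_mem.
Qed.

Definition haar w : V := indL (cell (true :: w)) - indL (cell (false :: w)).

Lemma sum_haar n (phi : seq bool -> R) :
  \sum_(w <- words n) phi w *:
    haar w = stepL n.+1 (fun w => phi (behead w) * sgb R (head true w)).
Proof.
rewrite /stepL sum_wordsS; apply: eq_bigr => w _ /=.
by rewrite /sgb /haar mulr1 mulrN1 scaleNr scalerBr.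
Qed.

Lemma stepL_behead n phi : stepL n phi = stepL n.+1 (fun w => phi (behead w)).
Proof.
by rewrite /stepL sum_wordsS; apply: eq_bigr => w _ /=;
  rewrite indL_split scalerDr.
Qed.

Definition rad n : V := \sum_(w <- words n) haar w.

Lemma radE n : rad n = stepL n.+1 (fun w => sgb R (head true w)).
Proof.
rewrite -[RHS](@eq_stepL _ (fun w => 1 * sgb R (head true w))) =>
  [|w _]; last by rewrite mul1r.
by rewrite -(sum_haar n (fun=> 1)); apply: eq_bigr => w _; rewrite scale1r.
Qed.

Lemma sum_rad a n : \sum_(0 <= i < n) a i *: rad i = stepL n (walk a).
Proof.
elim: n => [|n IH]; first by rewrite big_geq// /stepL /= big_seq1 /= scale0r.
rewrite big_nat_recr//= IH radE stepL_behead addrC -stepL_linear.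
apply: eq_stepL => -[//|b w] [wn] /=; by rewrite wn addrC mulrC.
Qed.

(** Stopping the walk removes from [\sum_i a i *: rad i] exactly the Haar
    functions of the nodes reached after the exit. *)
Lemma stopped_haar a n : stepL n (stopped a) =
  \sum_(0 <= i < n) \sum_(w <- words i) ((alive a w)%:R * a i) *: haar w.
Proof.
elim: n => [|n IH]; first by rewrite big_geq// /stepL /= big_seq1 /= scale0r.
rewrite big_nat_recr//= -IH sum_haar (stepL_behead n (stopped a))
  -[X in X + _]scale1r -stepL_linear.
apply: eq_stepL => -[//|b w] [wn] /=; rewrite /alive wn.
case: leP => _; first by rewrite mul0r mul0r addr0 mul1r.
by rewrite !mul1r (mulrC (a n)).
Qed.

Lemma stepL_sign n phi : (forall w, phi w ^+ 2 = 1) ->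
  \sum_(w <- words n) phi w = 0 ->
  (\forall x \ae mu, (stepL n phi x : R) ^+ 2 = \1_(cell [::]) x) /\
  (\int[mu]_x (stepL n phi x)%:E = 0)%E.
Proof.
move=> phi1 phi0; split.
  apply: filterS (stepLE n phi) => x ->; rewrite indicE.
  have [xc|xc] := pselect (cell [::] x).
    by have [v _ ->] := stepf_in n xc; rewrite phi1 mem_set.
  by rewrite stepf_out// memNset// expr0n.
transitivity (\int[mu]_x (stepf n phi x)%:E)%E.
  apply: ae_eq_integral => //.
  - by apply/measurable_EFinP; exact: Lspace_measurable.
  - by apply/measurable_EFinP; exact: measurable_stepf.
  by apply: filterS (stepLE n phi) => x ->.
by rewrite integral_stepf /avg phi0 mulr0 mulr0.
Qed.

End one_tree.
End trees.

(** * Lebesgue measure on the unit interval *)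

Section unit_interval.
Context (R : realType).
Local Notation mu := (lebesgue01 R).
Local Notation RT := (measurableTypeR R).

Lemma lebesgue01E (A : set RT) : mu A = lebesgue_measure (A `&` `[0, 1]).
Proof. by []. Qed.

Lemma lebesgue01_le1 (A : set RT) : measurable A -> (mu A <= 1)%E.
Proof.
move=> mA; rewrite lebesgue01E.
apply: (@le_trans _ _ (lebesgue_measure (`[0%R, 1%R]%classic : set R))).
  by apply: le_measure; rewrite ?inE//; exact: measurableI.
by rewrite lebesgue_measure_itv /= lte_fin ltr01 oppr0 adde0.
Qed.

Lemma lebesgue01_fin (A : set RT) : measurable A -> mu A \is a fin_num.
Proof.
move=> mA; rewrite ge0_fin_numE//.
by apply: le_lt_trans (lebesgue01_le1 mA) _; rewrite ltry.
Qed.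

(** The measure of the part of [B] below [t] is a 1-Lipschitz function of [t]
    with value 0 at 0 and [mu B] at 1; take [t] where it is half of [mu B]. *)
Lemma halving (B : set RT) : measurable B -> exists H : set RT,
  [/\ measurable H, H `<=` B & mu H = ((fine (mu B)) / 2)%:E].
Proof.
move=> mB.
pose H (t : R) : set RT := B `&` `]-oo, t]%classic.
have mH t : measurable (H t) by apply: measurableI.
pose F t := fine (mu (H t)).
have FE t : (F t)%:E = mu (H t) by rewrite fineK// lebesgue01_fin.
have Flip s t : s <= t -> F s <= F t <= F s + (t - s).
  move=> st; have Hs : H t = H s `|` (B `&` `]s, t]%classic).
    rewrite /H -setIUr; congr (_ `&` _); apply/seteqP;
      split=> x /=; rewrite !in_itv /=.
      by case: (leP x s) => h; [left|right].
    by case=> [/le_trans|/andP[]]//; apply.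
  have mst : measurable (B `&` `]s, t]%classic : set RT) by apply: measurableI.
  have small : (mu (B `&` `]s, t]%classic) <= (t - s)%:E)%E.
    rewrite lebesgue01E.
    apply: (@le_trans _ _ (lebesgue_measure (`]s, t]%classic : set R))).
      apply: le_measure; rewrite ?inE//; first exact: measurableI.
      by move=> x [[]].
    rewrite lebesgue_measure_itv /= lte_fin; case: ltP => // _.
    by rewrite lee_fin subr_ge0.
  apply/andP; split; rewrite -lee_fin ?[in leRHS]EFinD !FE.
    by apply: le_measure; rewrite ?inE// Hs; exact: subsetUl.
  rewrite Hs; apply: (@le_trans _ _ (mu (H s) + mu (B `&` `]s, t]%classic))%E);
    last exact: leeD2l.
  exact: measureU2.
have cF : continuous F.
  move=> t; apply/cvgrPdist_lt => eps e0; near=> s.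
  have : `|t - s| < eps by near: s; exact: cvgr_dist_lt.
  have [st|/ltW ts] := leP s t.
    have /andP[h1 h2] := Flip _ _ st; rewrite !ger0_norm ?subr_ge0//; lra.
  have /andP[h1 h2] := Flip _ _ ts; rewrite !ler0_norm ?subr_le0//; lra.
have F0 : F 0 = 0.
  apply: EFin_inj; rewrite FE; apply/eqP;
    rewrite eq_le measure_ge0 andbT lebesgue01E.
  apply: (@le_trans _ _ (lebesgue_measure ([set 0%R] : set R)));
    last by rewrite lebesgue_measure_set1.
  apply: le_measure; rewrite ?inE//; first by apply: measurableI.
  by move=> x [[_ /=]]; rewrite !in_itv /= => x0 /andP[x0' _];
    apply/eqP; rewrite eq_le x0 x0'.
have F1 : F 1 = fine (mu B).
  congr fine; rewrite !lebesgue01E; congr lebesgue_measure.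
  rewrite /H -setIA; congr (_ `&` _); apply/seteqP;
    split => [x []//|x /= x01]; split => //.
  by move: x01; rewrite !in_itv /= => /andP[].
have [||c _ hc] := @IVT R F 0 1 (fine (mu B) / 2) ler01.
- exact: continuous_subspaceT.
- have h0 : 0 <= fine (mu B) by rewrite fine_ge0.
  by rewrite F0 F1 /Num.min /Num.max; case: ltP => h; lra.
exists (H c); split => //; first exact: subIsetl.
by rewrite -hc FE.
Unshelve. all: by end_near. Qed.

Lemma lebesgue_measurable_borel (A : set R) : lebesgue_measurable A ->
  exists2 B : set RT, measurable B & \forall t \ae mu, (\1_A t : R) = \1_B t.
Proof.
rewrite /lebesgue_measurable -completed_caratheodory_measurable.
rewrite g_sigma_completed_algebra_genE => -[B mB [N [M [mM M0 NM]]] BN].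
exists B => //; exists M; split => //.
  apply/eqP; rewrite eq_le measure_ge0 andbT lebesgue01E -M0.
  by apply: le_measure; rewrite ?inE//; exact: measurableI.
move=> t /= tAB; apply: contrapT => tM; apply: tAB.
rewrite -BN !indicE in_setU [t \in N]memNset ?orbF// => /NM.
exact: tM.
Qed.

End unit_interval.

(** * Rademacher sums over a tree *)

Section signed_sums.
Context d (T : measurableType d) (R : realType).
Variables (mu : {measure set T -> \bar R}) (p : R) (p1 : (1 <= p%:E)%E).
Local Notation V := (LspaceType mu p1).
Variables (m : R) (cell : seq bool -> set T).
Hypothesis tr : tree mu m cell.
Hypothesis m01 : 0 <= m <= 1.
Local Notation haar := (haar mu p1 cell).
Local Notation rad := (rad mu p1 cell).
Local Notation stepL := (stepL mu p1 cell).

Let p_gt0 : 0 < p.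
Proof. by rewrite (lt_le_trans ltr01)// -lee_fin. Qed.

Lemma stepL_norm_le n phi c :
  0 <= c -> avg n (fun w => `|phi w| `^ p) <= c `^ p ->
  `|stepL n phi| <= c.
Proof.
move=> c0 h; rewrite leNgt; apply/negP => ch.
have : c `^ p < `|stepL n phi| `^ p by apply: gt0_ltr_powR; rewrite ?nnegrE.
rewrite (stepL_norm p1 tr) ltNge => /negP; apply.
apply: le_trans h; case/andP: m01 => m0 m1.
by rewrite ler_piMl// /avg mulr_ge0 ?exprn_ge0 ?invr_ge0// sumr_ge0//
  => w _; exact: powR_ge0.
Qed.

Definition khintchine_const : R := 4 * (p `^ p * (2 * expR 1)) `^ p^-1 ^+ 2.

(** The lemma [khintchine] applies after rescaling [\sum_i a i ^+ 2] to [1 / 4],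
    which is where the factor 4 of the constant comes from. *)
Lemma khintchine_rad n a :
  `|\sum_(0 <= i < n) a i *: rad i| ^+ 2 <= khintchine_const *
    \sum_(0 <= i < n) a i ^+ 2.
Proof.
set D := (p `^ p * (2 * expR 1)) `^ p^-1.
have D0 : 0 <= D by exact: powR_ge0.
set t := \sum_(0 <= i < n) a i ^+ 2.
have t0 : 0 <= t by apply: sumr_ge0 => i _; exact: sqr_ge0.
have [tz|tn0] := eqVneq t 0.
  have az i : (i < n)%N -> a i = 0.
    move=> ni; apply/eqP; rewrite -sqrf_eq0; apply/eqP.
    move: tz; rewrite /t big_mkord => /eqP.
    rewrite psumr_eq0 => [/allP h|j _]; last exact: sqr_ge0.
    by have /eqP := h (Ordinal ni) (mem_index_enum _).
  rewrite big_nat big1 ?normr0 ?expr0n ?tz ?mulr0// => i /andP[_ /az ->].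
  by rewrite scale0r.
have tp : 0 < t by rewrite lt_def tn0.
pose k := (2 * Num.sqrt t)^-1.
have sp : 0 < Num.sqrt t by rewrite sqrtr_gt0.
have k0 : 0 < k by rewrite invr_gt0 mulr_gt0.
have k2 : k ^+ 2 = (4 * t)^-1.
  by rewrite /k exprVn exprMn sqr_sqrtr//; congr (_^-1); ring.
have h : `|\sum_(0 <= i < n) (k * a i) *: rad i| <= D.
  rewrite (sum_rad p1 tr); apply: stepL_norm_le => //.
  rewrite /D -powRrM mulVf ?gt_eqF// powRr1; last first.
    by rewrite mulr_ge0 ?powR_ge0// mulr_ge0 ?expR_ge0.
  apply: khintchine => //.
  under eq_bigr do rewrite exprMn.
  by rewrite -mulr_sumr -/t k2 invfM mulfVK ?div1r.
have -> : \sum_(0 <= i < n) a i *: rad i = k^-1 *: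
  \sum_(0 <= i < n) (k * a i) *: rad i.
  rewrite scaler_sumr; apply: eq_bigr => i _.
  by rewrite scalerA mulrA mulVf ?gt_eqF// mul1r.
rewrite normrZ exprMn real_normK ?num_real//.
have -> : (k^-1 : R) ^+ 2 = 4 * t by rewrite exprVn k2 invrK.
rewrite /khintchine_const -/D.
by rewrite [leRHS]mulrAC ler_pM2l ?mulr_gt0// ler_pXn2r ?nnegrE.
Qed.

Section lower.
Variables (X : normedModType R) (S : {linear V -> X}).
Variables (K B delta eta alpha s : R).
Hypothesis K0 : 0 < K.
Hypothesis B0 : 0 < B.
Hypothesis SB : forall x, `|S x| <= B * `|x|.
Hypothesis delta0 : 0 < delta.
Hypothesis alpha01 : 0 < alpha <= 1.
Hypothesis s1 : 1 <= s.
Hypothesis small : alpha `^ p + 2 `^ p * (4 / s) <= (delta / (2 * B)) `^ p.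
Hypothesis eta_small : s * eta <= alpha * delta / 4.
Hypothesis sign_ge : forall n phi, (forall w, phi w ^+ 2 = 1) ->
  \sum_(w <- words n) phi w = 0 -> delta <= `|S (stepL n phi)|.
(** Up to small errors, [Q] keeps the images of the Haar functions of the nodes
    in [theta] and kills those of the other nodes. *)
Hypothesis blocks : forall n (theta : seq bool -> bool),
  exists (Q : {linear X -> X}) (err : seq bool -> R),
    [/\ forall x, `|Q x| <= K * `|x|,
        \sum_(0 <= i < n) \sum_(w <- words i) err w <= eta &
        forall w, (size w < n)%N -> `|Q (S (haar w)) - (theta w)%:R
          *: S (haar w)| <= err w].

Let block_sum n (theta : seq bool -> bool) (a : nat -> R) :
  \sum_(0 <= i < n) a i ^+ 2 = s ->
  `|\sum_(0 <= i < n) \sum_(w <- words i) ((theta w)%:R * a i) *: S (haar w)|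
  <= K * `|S (\sum_(0 <= i < n) a i *: rad i)| + s * eta.
Proof.
move=> as_; have [Q [err [QK errs herr]]] := blocks n theta.
have an i : (i < n)%N -> `|a i| <= s.
  move=> ni; have h : a i ^+ 2 <= s.
    rewrite -as_ big_mkord (bigD1 (Ordinal ni))//= lerDl.
    by apply: sumr_ge0 => *; exact: sqr_ge0.
  rewrite -(@ler_pXn2r _ 2) ?nnegrE//; last by rewrite (le_trans ler01).
  rewrite real_normK ?num_real//; apply: le_trans h _.
  by rewrite expr2 ler_peMl// (le_trans ler01).
have err0 w : (size w < n)%N -> 0 <= err w.
  by move=> /herr; apply: le_trans.
set lhs := \sum_(0 <= i < n) _.
have -> : lhs = Q (S (\sum_(0 <= i < n) a i *: rad i)) -
    \sum_(0 <= i < n) \sum_(w <- words i) a i *: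
      (Q (S (haar w)) - (theta w)%:R *: S (haar w)).
  rewrite (linear_sum S) (linear_sum Q) -sumrB; apply: eq_bigr => i _.
  rewrite 2!linearZ /= (linear_sum S) (linear_sum Q) scaler_sumr -sumrB.
  apply: eq_bigr => w _.
  by rewrite scalerBr opprB addrC subrK scalerA mulrC.
apply: le_trans (ler_normB _ _) _; apply: lerD; first exact: QK.
apply: le_trans (ler_norm_sum _ _ _) _.
apply: (@le_trans _ _ (s * \sum_(0 <= i < n) \sum_(w <- words i) err w));
  last first.
  by rewrite ler_wpM2l// (le_trans ler01).
rewrite mulr_sumr !big_nat; apply: ler_sum => i /andP[_ ni].
apply: le_trans (ler_norm_sum _ _ _) _;
  rewrite mulr_sumr !big_seq; apply: ler_sum => w.
rewrite mem_words => /eqP wi; rewrite normrZ ler_pM//; first exact: an.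
by apply: herr; rewrite wi.
Qed.

(** If all coefficients are at most [alpha], apply [block_sum] to the nodes where
    the stopped walk is alive; otherwise, to the level of a large coefficient. *)
Let lower_at n (a : nat -> R) : \sum_(0 <= i < n) a i ^+ 2 = s ->
  alpha * delta / 4 <= K * `|S (\sum_(0 <= i < n) a i *: rad i)|.
Proof.
move=> as_; case/andP: alpha01 => al0 al1.
have ad : alpha * delta <= delta by rewrite ler_piMl// ltW.
have [/forallP small_a|] := boolP [forall i : 'I_n, `|a i| <= alpha].
  have ha i : (i < n)%N -> `|a i| <= alpha.
    by move=> ni; exact: (small_a (Ordinal ni)).
  have := block_sum (alive a) as_.
  have -> : \sum_(0 <= i < n) \sum_(w <- words i) ((alive a w)%:R * a i) *:
    S (haar w)
      = S (stepL n (stopped a)).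
    rewrite (stopped_haar p1 tr) linear_sum; apply: eq_bigr => i _.
    by rewrite linear_sum; apply: eq_bigr => w _; rewrite linearZ.
  have := sign_ge (exit_sign_sqr a) (sum_exit_sign a n).
  set x := stepL n (stopped a); set y := stepL n.+1 _ => hy hx.
  have hxy : `|y - x| <= delta / (2 * B).
    have -> : y - x = stepL n.+1
      (fun w => -1 * stopped a (behead w) + exit_sign a w).
      by rewrite stepL_linear scaleN1r addrC /x (stepL_behead p1 tr).
    apply: stepL_norm_le; first by rewrite divr_ge0 ?mulr_ge0// ltW.
    apply: le_trans small; apply:
      (@le_trans _ _ (alpha `^ p + 2 `^ p * avg n (fun w => (alive a w)%:R))).
      rewrite -[X in X <= _](@eq_avg _ _
        (fun w => `|stopped a (behead w) - exit_sign a w| `^ p)).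
        by apply: avg_stopped_exit => //; exact: ltW.
      by move=> w _; rewrite distrC mulN1r [- _ + _]addrC.
    rewrite lerD2l ler_wpM2l ?powR_ge0//.
    apply: (@avg_alive_le _ a alpha n s) => //; first by rewrite ltW.
    exact: lt_le_trans s1.
  have : `|S y| <= `|S x| + delta / 2.
    rewrite -[y](subrK x) linearD addrC (le_trans (ler_normD _ _))// lerD2l.
    apply: le_trans (SB _) _; rewrite mulrC -ler_pdivlMr//.
    by rewrite -mulrA -invfM.
  move: hy hx eta_small ad.
  set Sy := `|S y|; set Sx := `|S x|; set Sr := K * _; set se := s * eta;
    set ad := alpha * delta.
  move: Sy Sx Sr se ad => Sy Sx Sr se ad; lra.
rewrite negb_forall => /existsP[[j jn] /=]; rewrite -ltNge => aj.
have := block_sum (fun w => size w == j) as_.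
have -> : \sum_(0 <= i < n) \sum_(w <- words i) ((size w == j)%:R * a i) *:
  S (haar w)
    = a j *: S (rad j).
  rewrite big_mkord (bigD1 (Ordinal jn))//= [X in _ + X]big1 ?addr0.
    rewrite /rad linear_sum scaler_sumr; apply: eq_big_seq => w.
    by rewrite mem_words => ->; rewrite mul1r.
  move=> i; rewrite -val_eqE /= => ij; rewrite big1_seq// => w /=.
  by rewrite mem_words => /eqP ->; rewrite (negbTE ij) mul0r scale0r.
have : delta <= `|S (rad j)|.
  rewrite radE; apply: sign_ge => [w|].
    by rewrite /sgb; case: head; rewrite ?sqrrN expr1n.
  by rewrite sum_wordsS big1// => w _ /=; rewrite subrr.
rewrite normrZ => h1 h2.
have : alpha * delta <= `|a j| * `|S (rad j)| by apply:
  ler_pM => //; exact: ltW.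
have : 0 <= alpha * delta by rewrite mulr_ge0// ltW.
move: h2 eta_small.
set aS := `|a j| * _; set Sr := K * _; set se := s * eta;
  set dl := alpha * delta.
move: aS Sr se dl => aS Sr se dl; lra.
Qed.

Lemma rad_lower n a :
  (alpha * delta / (4 * K)) ^+ 2 / s * \sum_(0 <= i < n) a i ^+ 2
  <= `|S (\sum_(0 <= i < n) a i *: rad i)| ^+ 2.
Proof.
set t := \sum_(0 <= i < n) a i ^+ 2.
have t0 : 0 <= t by apply: sumr_ge0 => i _; exact: sqr_ge0.
have [->|tn0] := eqVneq t 0; first by rewrite mulr0 sqr_ge0.
have tp : 0 < t by rewrite lt_def tn0.
have sp : 0 < s by exact: lt_le_trans s1.
pose k := Num.sqrt (s / t).
have k0 : 0 < k by rewrite sqrtr_gt0 divr_gt0.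
have k2 : k ^+ 2 = s / t by rewrite sqr_sqrtr// divr_ge0// ltW.
have := @lower_at n (fun i => k * a i).
under eq_bigr do rewrite exprMn.
rewrite -mulr_sumr -/t k2 divfK// => /(_ erefl).
have -> : \sum_(0 <= i < n) (k * a i) *: rad i = k *:
  \sum_(0 <= i < n) a i *: rad i.
  by rewrite scaler_sumr; apply: eq_bigr => i _; rewrite scalerA.
rewrite linearZ normrZ gtr0_norm//; set y := `|S _| => h.
case/andP: alpha01 => al0 al1.
have h2 : alpha * delta / (4 * K) <= k * y.
  by rewrite invfM mulrA ler_pdivrMr// [leRHS]mulrC.
have : (alpha * delta / (4 * K)) ^+ 2 <= (k * y) ^+ 2.
  rewrite ler_pXn2r ?nnegrE//; first by rewrite divr_ge0 ?mulr_ge0// ltW.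
  by rewrite mulr_ge0 ?(ltW k0)// normr_ge0.
rewrite [X in _ <= X -> _]exprMn k2 [s / t * _]mulrAC ler_pdivlMr// => h3.
by rewrite [_ / s * t]mulrAC ler_pdivrMr// [leRHS]mulrC.
Qed.

End lower.
End signed_sums.

(** * Trees adapted to a basis *)

Section block_projections.
Context (R : realType) (X : completeNormedModType R) (e : nat -> X).
Variables (be : schauder_basis e) (K : R).
Hypothesis K0 : 0 <= K.
Hypothesis projK : forall P M x, `|basis_proj be P M x| <= K * `|x|.
Variables (N : nat -> nat) (z : nat -> X) (err : nat -> R).
Hypothesis Nmono : forall i, (N i <= N i.+1)%N.
Hypothesis head_small : forall i, `|basis_proj be xpredT (N i) (z i)| <= err i.
Hypothesis tail_small : forall i, `|z i - basis_proj be xpredT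
  (N i.+1) (z i)| <= err i.

(** Each [z i] is within [2 * err i] of its coordinates from [N i]
    to [N i.+1]; the projection onto the union of the blocks in [theta] keeps or
    kills each block exactly. *)
Lemma block_projection (theta : nat -> bool) I :
  exists P M, forall i, (i < I)%N ->
  `|basis_proj be P M (z i) - (theta i)%:R *: z i| <= (K + 1) * (2 * err i).
Proof.
have mono i j : (i <= j)%N -> (N i <= N j)%N.
  by move=> /subnKC <-; elim: (j - i)%N => [|k IH];
    rewrite ?addn0// addnS (leq_trans IH).
pose P n := has (fun i => theta i && (N i <= n < N i.+1)%N) (iota 0 I).
exists P, (N I) => i iI.
pose y := \sum_(N i <= k < N i.+1 | xpredT k) basis_coef be (z i) k *: e k.
have yE : y = basis_proj be xpredT (N i.+1) (z i) -
  basis_proj be xpredT (N i) (z i).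
  by rewrite /basis_proj (@big_cat_nat _ _ _ (N i) 0 (N i.+1))//= addrAC subrr
    add0r.
have Py : basis_proj be P (N I) y = (theta i)%:R *: y.
  rewrite basis_proj_finite; last exact: mono.
  rewrite /y scaler_sumr big_mkcond /= big_nat [RHS]big_nat.
  apply: eq_bigr => k /andP[ki ik]; rewrite andbT.
  have -> : P k = theta i.
    apply/hasP/idP => [[j _ /andP[tj /andP[kj jk]]]|ti].
      have [ij|ji|ij] := ltngtP i j; last by rewrite ij.
        by have := leq_trans ik (leq_trans (mono _ _ ij) kj); rewrite ltnn.
      by have := leq_trans jk (leq_trans (mono _ _ ji) ki); rewrite ltnn.
    by exists i; rewrite ?mem_iota// ti ki ik.
  by case: (theta i); rewrite ?scale1r ?scale0r.
have zy : `|z i - y| <= 2 * err i.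
  rewrite yE opprB addrCA addrC mulr_natl mulr2n
    (le_trans (ler_normD _ _))// lerD//.
have -> : basis_proj be P (N I) (z i) - (theta i)%:R *: z i =
    basis_proj be P (N I) (z i - y) - (theta i)%:R *: (z i - y).
  by rewrite linearB /= Py scalerBr opprB addrA subrK.
apply: le_trans (ler_normB _ _) _; rewrite mulrDl mul1r lerD//.
  apply: le_trans (projK _ _ _) _; rewrite ler_wpM2l//.
by case: (theta i); rewrite ?scale1r// scale0r normr0 (le_trans _ zy).
Qed.

End block_projections.

(** Rank of a node when the tree is read level by level: the children of the
    node [i] are [2 * i + 1] and [2 * i + 2]. *)
Fixpoint heap w : nat :=
  if w is b :: w' then (2 * heap w' + (if b then 1 else 2))%N else 0%N.

Lemma heap_inj : injective heap.
Proof.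
elim=> [|b w IH] [|c v] //=; first by case: c; rewrite !addnS.
  by case: b; rewrite !addnS.
move=> h; have bc : b = c.
  by move: (congr1 odd h);
    rewrite !mul2n !oddD !odd_double; case: b c {h} => -[].
by move: h; rewrite bc => /addIn /eqP; rewrite eqn_pmul2l// => /eqP /IH ->.
Qed.

(** As [q := 2^-1 ^+ (heap w).+1] is at most [1 / 2], the children of [w] weigh
    together [q ^+ 2 * 3 / 2 <= 3 / 4 * q]. *)
Lemma sum_heap_weights (R : realType) n :
  \sum_(0 <= i < n) \sum_(w <- words i) (2^-1 : R) ^+ (heap w).+1 <= 2.
Proof.
have wle i : \sum_(w <- words i) (2^-1 : R) ^+ (heap w).+1
  <= 2^-1 * (3 / 4) ^+ i.
  elim: i => [|i IH]; first by rewrite /= big_seq1 /= expr0 mulr1 expr1.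
  rewrite sum_wordsS exprS mulrCA; apply: le_trans (ler_wpM2l _ IH);
    last by rewrite divr_ge0.
  rewrite mulr_sumr; apply: ler_sum => w _ /=.
  rewrite (_ : (2 * heap w + 1).+1 = (heap w).+1 + (heap w).+1)%N;
    last by rewrite mul2n -addnn addn1 addSn addnS.
  rewrite (_ : (2 * heap w + 2).+1 = ((heap w).+1 + (heap w).+1).+1)%N;
    last by rewrite mul2n -addnn addn2 addSn addnS.
  rewrite exprS exprD; set q := 2^-1 ^+ _.
  have q0 : 0 <= q by rewrite exprn_ge0// invr_ge0.
  have q1 : q <= 2^-1 by rewrite /q exprS ler_piMr ?invr_ge0// exprn_ile1
    ?invr_ge0// invf_le1// ler1n.
  rewrite -[X in X + _]mul1r -mulrDl mulrA ler_wpM2r//.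
  lra.
apply: (@le_trans _ _ (\sum_(0 <= i < n) 2^-1 * (3 / 4) ^+ i)).
  by apply: ler_sum => i _; exact: wle.
have -> : \sum_(0 <= i < n) 2^-1 * (3 / 4) ^+ i = 2 - 2 * (3 / 4 : R) ^+ n.
  elim: n => [|n IH]; first by rewrite big_geq// expr0 mulr1 subrr.
  by rewrite big_nat_recr//= IH exprS; field.
by rewrite lerBlDr lerDl mulr_ge0// exprn_ge0// divr_ge0.
Qed.

Section halving_trees.
Context d (T : measurableType d) (R : realType)
  (mu : {measure set T -> \bar R}).
Hypothesis mu_fin : forall A : set T, measurable A -> mu A \is a fin_num.
Implicit Types B H : set T.

Definition half_of B H :=
  [/\ measurable H, H `<=` B & mu H = ((fine (mu B)) / 2)%:E].

Lemma half_ofD B H : measurable B -> half_of B H -> half_of B (B `\` H).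
Proof.
move=> mB [mH HB Hm]; split; [exact: measurableD|exact: subDsetl|].
rewrite measureD//=; last by rewrite -ge0_fin_numE// mu_fin.
rewrite setIidr// Hm -[in LHS](fineK (mu_fin mB)) -EFinB.
by congr (_%:E); rewrite {1}[fine _]splitr addrK.
Qed.

Lemma tree_of_halves (cell : seq bool -> set T) : measurable (cell [::]) ->
  (forall w, measurable (cell w) -> half_of (cell w) (cell (true :: w))) ->
  (forall w, cell (false :: w) = cell w `\` cell (true :: w)) ->
  tree mu (fine (mu (cell [::]))) cell.
Proof.
move=> m0 hT hF.
have mc w : measurable (cell w).
  elim: w => // -[] w IH; first by have [] := hT w IH.
  by rewrite hF; apply: measurableD => //; have [] := hT w IH.
have hb w b : half_of (cell w) (cell (b :: w)).
  by case: b; [exact: hT|rewrite hF; apply: half_ofD => //; exact: hT].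
split => // [w|w|].
- by rewrite hF setDUK//; have [] := hT w (mc w).
- by rewrite hF setDIK.
elim=> [|b w IH] /=; first by rewrite expr0 mulr1 fineK// mu_fin.
have [_ _ ->] := hb w b; rewrite IH /=; congr (_%:E).
by rewrite exprSr mulrA.
Qed.

Lemma plain_tree B : (forall B', measurable B' -> exists H, half_of B' H) ->
  measurable B -> exists2 cell, cell [::] = B & tree mu (fine (mu B)) cell.
Proof.
move=> hv mB.
have /choice[half hh] : forall B, exists H, measurable B -> half_of B H.
  move=> B'; have [/hv[H hH]|nB] := pselect (measurable B'); first by exists H.
  by exists set0.
pose fix cell w := if w is b :: w' then
  (if b then half (cell w') else cell w' `\` half (cell w')) else B.
by exists cell => //; apply: (@tree_of_halves cell) => // w mw; exact: hh.
Qed.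

End halving_trees.

Section adaptive_tree.
Context d (T : measurableType d) (R : realType)
  (mu : {measure set T -> \bar R}).
Variables (p : R) (p1 : (1 <= p%:E)%E).
Local Notation V := (LspaceType mu p1).
Hypothesis mu_le1 : forall A : set T, measurable A -> (mu A <= 1)%E.
Hypothesis halves : forall B : set T, measurable B -> exists H, half_of mu B H.
Context (X : completeNormedModType R) (e : nat -> X).
Variables (be : schauder_basis e) (K : R).
Hypothesis K0 : 0 <= K.
Hypothesis projK : forall P M x, `|basis_proj be P M x| <= K * `|x|.
Variables (S : {linear V -> X}) (C : R).
Hypothesis C0 : 0 <= C.
Hypothesis SC : forall x, `|S x| <= C * `|x|.

Let mu_fin (A : set T) : measurable A -> mu A \is a fin_num.
Proof. by move=> mA; rewrite ge0_fin_numE//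
  (le_lt_trans (mu_le1 mA))// ltry. Qed.

Let mu01 (A : set T) : measurable A -> 0 <= fine (mu A) <= 1.
Proof.
by move=> mA; rewrite fine_ge0//= -lee_fin fineK ?mu_fin// mu_le1.
Qed.

Let diffL (B H : set T) : V := indL mu p1 H - indL mu p1 (B `\` H).

Let rad_half (B : set T) (cell : seq bool -> set T) j : cell [::] = B ->
  tree mu (fine (mu B)) cell ->
  exists2 H, half_of mu B H & rad mu p1 cell j = diffL B H.
Proof.
move=> cB tr.
pose hd w : R := if head true w then 1 else 0.
pose H := [set x | stepf cell j.+1 hd x = 1].
have HB : H `<=` B.
  move=> x; rewrite /H /= -cB => h; apply: contrapT => xB; move: h.
  by rewrite (stepf_out tr)// => /esym/eqP; rewrite oner_eq0.
have Hst x : \1_H x = stepf cell j.+1 hd x.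
  rewrite indicE; have [xB|xB] := pselect (cell [::] x); last first.
    by rewrite (stepf_out tr)// memNset// => /HB; rewrite -cB.
  have [v _ hv] := stepf_in tr j.+1 xB; rewrite hv /hd.
  case: ifP => hd1; first by rewrite mem_set// /H /= hv /hd hd1.
  by rewrite memNset// /H /= hv /hd hd1 => /esym/eqP; rewrite oner_eq0.
have mB : measurable B by rewrite -cB; exact: (tree_meas tr).
have mH : measurable H.
  have := measurable_stepf tr j.+1 hd measurableT (measurable_set1 (1 : R)).
  by rewrite setTI.
have muH : mu H = (fine (mu B) / 2)%:E.
  transitivity (\int[mu]_x (stepf cell j.+1 hd x)%:E)%E.
    rewrite -[in LHS](setIT H) -integral_indic//.
    by apply: eq_integral => x _; rewrite Hst.
  rewrite (integral_stepf_ge0 tr); last by move=> w; rewrite /hd; case: head.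
  rewrite avgS (@eq_avg _ _ _ (fun=> 2^-1)) ?avg_cst// => w _.
  by rewrite /hd /= addr0 mul1r.
exists H => //; rewrite radE; apply: Lspace_eq_ae.
have fin_ (A : set T) : measurable A -> (mu A < +oo)%E.
  by move=> mA; rewrite -ge0_fin_numE// mu_fin.
have mBH : measurable (B `\` H) by exact: measurableD.
have h1 := stepLE p1 tr j.+1 (fun w => sgb R (head true w)).
have h2 := indLE p1 mH (fin_ _ mH).
have h3 := indLE p1 mBH (fin_ _ mBH).
have h4 := Lspace_scale_addE (-1) (indL mu p1 (B `\` H)) (indL mu p1 H).
rewrite scaleN1r addrC -/(diffL B H) in h4.
have {h2 h3}h4 : \forall x \ae mu, (diffL B H x : R) = \1_H x - \1_(B `\` H) x.
  by move: h2 h3 h4; apply: filterS3 => x -> -> ->; rewrite mulN1r addrC.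
move: h1 h4; apply: filterS2 => x -> ->; rewrite Hst indicE in_setD.
have [xB|xB] := pselect (cell [::] x); last first.
  by rewrite !(stepf_out tr)// [x \in B]memNset -?cB//= subrr.
have [v _ hv] := stepf_in tr j.+1 xB; rewrite !hv [x \in B]mem_set -?cB//=.
have := Hst x; rewrite indicE hv /sgb /hd.
case: head; case: (x \in H) => /= /eqP;
  rewrite ?oner_eq0 ?[0 == 1]eq_sym ?oner_eq0//.
  by rewrite subr0.
by rewrite sub0r.
Qed.

(** Otherwise the projections of the images of all the Rademacher functions of
    a tree on [B] have norm at least [eps]. Summed over [m] of these functions,
    the absolute values of one coordinate are the coordinate of the image of a
    signed sum, which is of order [sqrt m] by Khintchine's inequality; but the
    [N] coordinates together must account for [m * eps]. *)
Lemma good_half (B : set T) N eps : measurable B -> 0 < eps ->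
  exists2 H, half_of mu B H & `|basis_proj be xpredT N (S (diffL B H))| < eps.
Proof.
move=> mB e0; have [cell cB tr] := plain_tree mu_fin halves mB.
apply: contrapT => nH.
have big j : eps <= `|basis_proj be xpredT N (S (rad mu p1 cell j))|.
  rewrite leNgt; apply/negP => small; apply: nH.
  by have [H hH rH] := rad_half j cB tr; exists H => //; rewrite -rH.
pose kc := khintchine_const p.
have kc0 : 0 <= kc by apply: mulr_ge0 => //; exact: sqr_ge0.
pose D m := Num.sqrt (kc * m%:R).
have one k m : \sum_(0 <= j < m) `|basis_proj be (pred1 k) k.+1
  (S (rad mu p1 cell j))| <= K * (C * D m).
  pose c j := basis_coef be (S (rad mu p1 cell j)) k.
  have -> : \sum_(0 <= j < m) `|basis_proj be (pred1 k) k.+1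
    (S (rad mu p1 cell j))| =
      `|basis_proj be (pred1 k) k.+1
        (S (\sum_(0 <= j < m) Num.sg (c j) *: rad mu p1 cell j))|.
    rewrite (linear_sum S) (linear_sum (basis_proj be (pred1 k) k.+1)).
    rewrite (eq_bigr (fun j => `|c j| *: e k)) => [|j _]; last first.
      by rewrite 2!linearZ /= basis_proj1 scalerA -normrEsg.
    rewrite -scaler_suml normrZ ger0_norm ?sumr_ge0// mulr_suml.
    by apply: eq_bigr => j _; rewrite basis_proj1 normrZ.
  apply: le_trans (projK _ _ _) _; rewrite ler_wpM2l//.
  apply: le_trans (SC _) _; rewrite ler_wpM2l//.
  rewrite -(@ler_pXn2r _ 2) ?nnegrE ?sqrtr_ge0// sqr_sqrtr;
    last by rewrite mulr_ge0.
  apply: le_trans (khintchine_rad p1 tr (mu01 mB) _ _) _.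
  rewrite ler_wpM2l//.
  rewrite -[X in _ <= X%:R](subn0 m) -sumr_const_nat.
  by apply: ler_sum => j _; rewrite -real_normK ?num_real// normr_sg; case:
    (_ == 0) => /=; rewrite ?expr0n ?expr1n.
have all_ m : m%:R * eps <= N%:R * (K * (C * D m)).
  apply: (@le_trans _ _ (\sum_(0 <= j < m) `|basis_proj be xpredT N
    (S (rad mu p1 cell j))|)).
    rewrite mulr_natl -[in leLHS](subn0 m) -sumr_const_nat.
    by apply: ler_sum => j _; exact: big.
  apply: (@le_trans _ _ (\sum_(0 <= j < m) \sum_(0 <= k < N) `|basis_proj be
    (pred1 k) k.+1 (S (rad mu p1 cell j))|)).
    apply: ler_sum => j _; apply: le_trans (ler_norm_sum _ _ _) _.
    by apply: ler_sum => k _; rewrite basis_proj1.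
  rewrite exchange_big /= mulr_natl -[in leRHS](subn0 N) -sumr_const_nat.
  by apply: ler_sum => k _; exact: one.
pose Z := (N%:R * (K * C)) ^+ 2 * kc / eps ^+ 2.
pose m := (Num.truncn Z).+1.
have Zm : Z < m%:R by exact: truncnS_gt.
have m0 : (0 : R) < m%:R by rewrite ltr0n.
have : (m%:R * eps) ^+ 2 <= (N%:R * (K * (C * D m))) ^+ 2.
  rewrite ler_pXn2r ?nnegrE ?mulr_ge0 ?sqrtr_ge0 ?(ltW e0)//; exact: all_.
have -> : (N%:R * (K * (C * D m))) ^+ 2 = m%:R * ((N%:R * (K * C)) ^+ 2 * kc).
  have D2 : D m ^+ 2 = kc * m%:R by rewrite sqr_sqrtr// mulr_ge0.
  have -> : N%:R * (K * (C * D m)) = N%:R * (K * C) * D m by rewrite !mulrA.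
  by rewrite exprMn D2 [RHS]mulrC -[RHS]mulrA.
have -> : (m%:R * eps) ^+ 2 = m%:R * (m%:R * eps ^+ 2) by ring.
rewrite ler_pM2l// leNgt => /negP; apply.
by move: Zm; rewrite /Z ltr_pdivrMr// exprn_gt0.
Qed.

(** The nodes are split one at a time in the order of [heap]. The half given to
    node [i] makes the first [N i] coordinates of the image of its Haar function
    small, and [N i.+1] is then chosen beyond the essential part of it. *)
Lemma adaptive_tree (B : set T) (eps : nat -> R) : measurable B ->
  (forall i, 0 < eps i) -> exists (cell : seq bool -> set T) (N : nat -> nat),
  [/\ cell [::] = B, tree mu (fine (mu B)) cell, forall i, (N i <= N i.+1)%N &
    forall w, let z := S (haar mu p1 cell w) in
      `|basis_proj be xpredT (N (heap w)) z| <= eps (heap w) /\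
      `|z - basis_proj be xpredT (N (heap w).+1) z| <= eps (heap w)].
Proof.
move=> mB e0.
have /choice[gh ghP] : forall x :
  set T * nat * R, exists H, measurable x.1.1 -> 0 < x.2 ->
    half_of mu x.1.1 H /\ `|basis_proj be xpredT x.1.2
      (S (diffL x.1.1 H))| < x.2.
  move=> [[A N] r] /=; have [[mA r0]|h] := pselect (measurable A /\ 0 < r).
    by have [H hH sH] := good_half N mA r0; exists H.
  by exists set0 => mA r0; case: h.
have /choice[cut cutP] : forall x : X * nat * R, exists N', (x.1.2 <= N')%N /\
    (0 < x.2 -> `|x.1.1 - basis_proj be xpredT N' x.1.1| < x.2).
  move=> [[y N] r] /=; have [r0|r0] := boolP (0 < r); last by exists N.
  have /cvgrPdist_lt/(_ _ r0)[n _ hn] := @basis_proj_cvg _ _ _ be y.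
  by exists (maxn N n); split;
    [exact: leq_maxl|move=> _; apply: hn; exact: leq_maxr].
(* [st k] consists of the sets given to the nodes so far and of the current
   cutoff, just before node [k] is split. *)
pose fix st k : (nat -> set T) * nat := if k is i.+1 then
    let A := (st i).1 in let N := (st i).2 in let H := gh (A i, N, eps i) in
    (fun j => if (j == 2 * i + 1)%N then H else if (j == 2 * i + 2)%N
      then A i `\` H else A j,
     cut (S (diffL (A i) H), N, eps i))
  else (fun=> B, 0%N).
pose A j := (st j).1 j; pose N j := (st j).2; pose H i := gh (A i, N i, eps i).
have left_ i k : (i < k)%N -> (st k).1 (2 * i + 1)%N = H i.
  elim: k => // k IH; rewrite ltnS leq_eqVlt => /orP[/eqP ->|ik]
    /=; first by rewrite eqxx.
  rewrite eqn_add2r eqn_pmul2l// ltn_eqF//= IH//.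
  by rewrite ltn_eqF// addn1 addn2 !ltnS leq_pmul2l// ltnW// ltnW.
have right_ i k : (i < k)%N -> (st k).1 (2 * i + 2)%N = A i `\` H i.
  elim: k => // k IH; rewrite ltnS leq_eqVlt => /orP[/eqP ->|ik] /=.
    by rewrite eqn_add2l/= eqxx.
  have i1k : (2 * i + 2 < 2 * k + 1)%N.
    by rewrite addn1 ltnS -mulnSr leq_pmul2l.
  by rewrite ltn_eqF// ltn_eqF ?IH// (ltn_trans i1k)// ltn_add2l.
pose cell w := A (heap w).
have cT w : cell (true :: w) = H (heap w).
  by rewrite /cell /= /A left_// addn1 ltnS leq_pmull.
have cF w : cell (false :: w) = cell w `\` cell (true :: w).
  by rewrite cT /cell /= {1}/A right_// addn2 ltnS ltnW// ltnS leq_pmull.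
have hh w : measurable (cell w) -> half_of mu (cell w) (cell (true :: w)).
  by move=> mw; rewrite cT;
    have [] := ghP (A (heap w), N (heap w), eps (heap w)) mw (e0 _).
have tr : tree mu (fine (mu (cell [::]))) cell by exact: tree_of_halves.
have hw w : haar mu p1 cell w = diffL (A (heap w)) (H (heap w)).
  by rewrite /haar cF cT.
exists cell, N; split => // [i|w /=].
  by have [] := cutP (S (diffL (A i) (H i)), N i, eps i).
rewrite hw; split.
  have [_ /ltW] := ghP (A (heap w), N (heap w), eps (heap w))
    (tree_meas tr w) (e0 _).
  exact.
have [_ /(_ (e0 _))/ltW] := cutP
  (S (diffL (A (heap w)) (H (heap w))), N (heap w), eps (heap w)).
exact.
Qed.

End adaptive_tree.

(** * Non-narrow operators fix a copy of the square summable sequences *)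

Section not_narrow.
Context (R : realType) (p : R) (p_gt1 : 1 < p).
Context (X : completeNormedModType R) (T : {linear Lp01 p_gt1 -> X}).
Context (e : nat -> X) (be : schauder_basis e) (K C : R).
Hypothesis K0 : 0 < K.
Hypothesis projK : forall P M x, `|basis_proj be P M x| <= K * `|x|.
Hypothesis C0 : 0 < C.
Hypothesis TC : forall x, `|T x| <= C * `|x|.

Let p1 : (1 <= p%:E)%E := ltW p_gt1.

Lemma ell2_copy_of_not_narrow (B : set (measurableTypeR R)) (delta : R) :
  measurable B -> 0 < delta ->
  (forall x : Lp01 p_gt1, (\forall t \ae lebesgue01 R, (x t : R) ^+ 2 = \1_B t)
    ->
    (\int[lebesgue01 R]_t (x t)%:E = 0)%E -> delta <= `|T x|) ->
  ~ strictly_singular (ell2 R) T.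
Proof.
move=> mB d0 signs.
have p0 : 0 < p by exact: lt_trans p_gt1.
pose gamma := delta / (2 * C).
have g0 : 0 < gamma by rewrite divr_gt0// mulr_gt0.
(* [alpha] and [s] make the overshoot and the surviving paths contribute at
   most [gamma `^ p / 2] each. *)
pose alpha := Num.min 1 (gamma / 2).
have al : 0 < alpha <= 1 by rewrite lt_min ltr01 divr_gt0//= ge_min lexx.
pose s := Num.max 1 (8 * 2 `^ p / gamma `^ p).
have s1 : 1 <= s by rewrite le_max lexx.
have s0 : 0 < s by exact: lt_le_trans s1.
have gp0 : 0 < gamma `^ p by exact: powR_gt0.
have two_p0 : (0 : R) < 2 `^ p by exact: powR_gt0.
have small : alpha `^ p + 2 `^ p * (4 / s) <= (delta / (2 * C)) `^ p.
  rewrite -/gamma [leRHS]splitr lerD//.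
    apply: (@le_trans _ _ ((gamma / 2) `^ p)).
      case/andP: al => al0 _; apply: ge0_ler_powR;
        rewrite ?nnegrE ?(ltW al0) ?(ltW p0) ?(divr_ge0 (ltW g0))//.
      by rewrite /alpha ge_min lexx orbT.
    rewrite powRM ?invr_ge0 ?(ltW g0)// ler_pM2l//.
    by apply: ge1r_powR; [rewrite invr_gt0 ltr0n invf_le1// ler1n|exact: ltW].
  rewrite mulrA ler_pdivrMr// -ler_pdivrMl ?divr_gt0//.
  rewrite (_ : (gamma `^ p / 2)^-1 * (2 `^ p * 4) = 8 * 2 `^ p / gamma `^ p);
    last first.
    by field; rewrite gt_eqF.
  by rewrite /s le_max lexx orbT.
pose eta := alpha * delta / (4 * s).
have eta0 : 0 < eta by case/andP: al => al0 _; rewrite divr_gt0// mulr_gt0.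
have eta_small : s * eta <= alpha * delta / 4.
  by rewrite /eta le_eqVlt; apply/orP; left; apply/eqP; field; rewrite gt_eqF.
(* The weights of [sum_heap_weights] add up to at most 2, and [block_projection]
   multiplies the errors by [2 * (K + 1)]. *)
pose w0 := eta / (4 * (K + 1)).
have K1 : 0 < K + 1 by rewrite addr_gt0.
have w00 : 0 < w0 by rewrite divr_gt0// mulr_gt0.
pose eps i := w0 * 2^-1 ^+ i.+1.
have eps0 i : 0 < eps i by rewrite mulr_gt0// exprn_gt0// invr_gt0.
have [cell [N [cB tr Nmono hw]]] := @adaptive_tree _ _ _ _ p p1
  (@lebesgue01_le1 R) (@halving R)
  X e be K (ltW K0) projK T C (ltW C0) TC B eps mB eps0.
have m01 : 0 <= fine (lebesgue01 R B) <= 1.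
  by rewrite fine_ge0//= -lee_fin fineK ?lebesgue01_fin// lebesgue01_le1.
have sign_ge n phi : (forall w, phi w ^+ 2 = 1) ->
  \sum_(w <- words n) phi w = 0 ->
    delta <= `|T (stepL (lebesgue01 R) p1 cell n phi)|.
  move=> h1 h2; have [h3 h4] := stepL_sign p1 tr h1 h2; apply: signs => //.
  by rewrite -cB.
have blocks n (theta : seq bool -> bool) :
  exists (Q : {linear X -> X}) (err : seq bool -> R),
    [/\ forall x, `|Q x| <= K * `|x|,
        \sum_(0 <= i < n) \sum_(w <- words i) err w <= eta &
        forall w, (size w < n)%N ->
          `|Q (T (haar (lebesgue01 R) p1 cell w)) - (theta w)%:R *:
            T (haar (lebesgue01 R) p1 cell w)| <= err w].
  pose unheap i := xget [::] [set w | heap w = i].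
  have unheapK w : unheap (heap w) = w.
    by apply: heap_inj; exact: (@xgetI _ _ [set v | heap v = heap w] w).
  pose z i := if heap (unheap i) == i then T
    (haar (lebesgue01 R) p1 cell (unheap i)) else 0.
  have zE w : z (heap w) = T (haar (lebesgue01 R) p1 cell w) by
    rewrite /z unheapK eqxx.
  have zh i : `|basis_proj be xpredT (N i) (z i)| <= eps i.
    rewrite /z; case: eqP => [h|_];
      first by have := hw (unheap i); rewrite h /= => -[].
    by rewrite linear0 normr0 ltW.
  have zt i : `|z i - basis_proj be xpredT (N i.+1) (z i)| <= eps i.
    rewrite /z; case: eqP => [h|_];
      first by have := hw (unheap i); rewrite h /= => -[].
    by rewrite linear0 subr0 normr0 ltW.
  pose I := (\max_(i < n) \max_(w <- words i) (heap w).+1)%N.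
  have [P [M PM]] := block_projection (ltW K0) projK Nmono zh zt
    (fun i => theta (unheap i)) I.
  exists (basis_proj be P M), (fun w => (K + 1) * (2 * eps (heap w))); split.
  - by move=> x; exact: projK.
  - have -> : \sum_(0 <= i < n) \sum_(w <- words i)
    (K + 1) * (2 * eps (heap w)) =
        (K + 1) * 2 * w0 * \sum_(0 <= i < n)
          \sum_(w <- words i) 2^-1 ^+ (heap w).+1.
      rewrite mulr_sumr; apply: eq_bigr => i _; rewrite mulr_sumr.
      by apply: eq_bigr => w _; rewrite /eps !mulrA.
    apply: le_trans (ler_wpM2l _ (sum_heap_weights R n)) _.
      by rewrite (mulr_ge0 (mulr_ge0 (ltW K1) (ler0n _ 2)) (ltW w00)).
    by rewrite /w0 le_eqVlt; apply/orP; left; apply/eqP; field; rewrite gt_eqF.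
  - move=> w wn; have := PM (heap w); rewrite zE unheapK; apply.
    have h1 : (\max_(v <- words (size w)) (heap v).+1 <= I)%N.
      exact: (@leq_bigmax _ (fun i : 'I_n => \max_(v <- words i) (heap v).+1)%N
        (Ordinal wn)).
    apply: leq_trans h1; apply:
      (@leq_bigmax_seq _ _ xpredT (fun v => (heap v).+1)) => //.
    by rewrite mem_words.
apply: (@not_strictly_singular_of_ell2 _ _ _ T C (khintchine_const p)
  ((alpha * delta / (4 * K)) ^+ 2 / s) (rad (lebesgue01 R) p1 cell)).
- exact: Lspace_complete.
- by apply: mulr_ge0 => //; exact: sqr_ge0.
- by case/andP: al => al0 _; rewrite divr_gt0// exprn_gt0// divr_gt0 ?mulr_gt0.
- exact: TC.
- by move=> n a; exact: khintchine_rad tr m01 n a.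
- by move=> n a; exact:
  (rad_lower tr m01 K0 C0 TC d0 al s1 small eta_small sign_ge blocks n a).
Qed.

End not_narrow.

Theorem theoremB (R : realType) (p : R) (p_gt1 : 1 < p)
    (X : completeNormedModType R) (T : {linear Lp01 p_gt1 -> X}) :
  (exists e : nat -> X, unconditional_basis e) ->
  bounded_on [set: Lp01 p_gt1] T ->
  strictly_singular (ell2 R) T ->
  narrow T.
Proof.
move=> [e ue] [C0 TC0] Tss; have [be _] := ue.
have [K K0 projK] := unconditional_constant be ue.
pose C := `|C0| + 1.
have C1 : 0 < C by rewrite ltr_wpDl.
have TC x : `|T x| <= C * `|x|.
  apply: le_trans (TC0 x (mem_set I)) _; rewrite ler_wpM2r//.
  by rewrite (le_trans (ler_norm _))// lerDl.
move=> eps A eps0 mA _; apply: contrapT => nA.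
have [B mB AB] := lebesgue_measurable_borel mA.
apply: (ell2_copy_of_not_narrow K0 projK C1 TC mB eps0) Tss => x x2 x0.
rewrite leNgt; apply/negP => Tx; apply: nA; exists x; split => //.
by move: x2 AB; apply: filterS2 => t -> ->.
Qed.
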